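(* Let $n\ge2$. For any $\varepsilon\in(0,1/\sqrt3)$, that is, for $\varepsilon=\cos(\theta/2)$ with $\theta\in(2\arccos(1/\sqrt3),\pi)$, there exist some $\alpha=\alpha(\varepsilon)\in(1,2)$ and a constant $a_0$ such that, for every $a>a_0$ and every $u\in C_0^\infty(Q_\theta)$, $$\int_{Q_\theta}e^{2\phi(x,t)}\Big[a\big(\Lambda(t)+\varphi(x)\big)u^2+|\nabla u|^2\Big]\,dx\,dt\le 4\int_{Q_\theta}e^{2\phi(x,t)}\,|\partial_t u+\Delta u|^2\,dx\,dt,$$ where $$\Lambda(t)=\frac{1-t}{t^{\alpha/2}},\qquad \varphi(x)=x_1^\alpha-\varepsilon^\alpha|x|^\alpha,\qquad \phi(x,t)=a\,\Lambda(t)\,\varphi(x)+t^2 .$$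
   Context: Write $x=(x_1,x')\in\mathbb R\times\mathbb R^{n-1}$. The cone with opening angle $\theta$ is $\mathcal O_\theta=\{x\in\mathbb R^n : x_1>|x|\cos(\theta/2)\}$, and $Q_\theta=(\mathcal O_\theta\cap\{x_1>1\})\times(0,1)$. $C_0^\infty(Q_\theta)$ denotes the smooth real-valued functions with compact support in the open set $Q_\theta$. The operators $\nabla$ and $\Delta$ act in the space variable $x$ only. *)

(* Defs.v *)
From HB Require Import structures.
From mathcomp Require Import all_boot all_order all_algebra.
From mathcomp Require Import all_classical all_reals all_analysis.

Set Implicit Arguments.
Unset Strict Implicit.
Unset Printing Implicit Defensive.

Import Order.TTheory GRing.Theory Num.Theory.
Import numFieldNormedType.Exports.

Local Open Scope classical_set_scope.
Local Open Scope ring_scope.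

Section lebesgue_tuple.
Context (R : realType).
Local Notation RT := (measurableTypeR R).

Definition tuple_cons n (p : RT * n.-tuple RT) : n.+1.-tuple RT :=
  [tuple of p.1 :: p.2].

Lemma measurable_tuple_cons n : measurable_fun setT (@tuple_cons n).
Proof. exact: (measurable_cons measurable_fst measurable_snd). Qed.

Section step.
Context n (mu : {sigma_finite_measure set (n.-tuple RT) -> \bar R}).

Definition lebesgue_tuple_step : set (n.+1.-tuple RT) -> \bar R :=
  pushforward (@lebesgue_measure R \x mu)%E (@tuple_cons n).

Let mE A : measurable A -> measurable (@tuple_cons n @^-1` A).
Proof.
by move=> mA; rewrite -[X in measurable X]setTI; exact: measurable_tuple_cons.
Qed.

Let step0 : lebesgue_tuple_step set0 = 0%E.
Proof. by rewrite /lebesgue_tuple_step /pushforward preimage_set0 measure0. Qed.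

Let step_ge0 A : (0 <= lebesgue_tuple_step A)%E.
Proof. exact: (measure_ge0 (@lebesgue_measure R \x mu)%E). Qed.

Let step_sigma_additive : semi_sigma_additive lebesgue_tuple_step.
Proof.
move=> F mF tF mUF; rewrite /lebesgue_tuple_step /pushforward preimage_bigcup.
apply: measure_semi_sigma_additive.
- by move=> i; exact: mE.
- apply/trivIsetP => /= i j _ _ ij; rewrite -preimage_setI.
  by move/trivIsetP : tF => /(_ _ _ _ _ ij) ->//; rewrite preimage_set0.
- by rewrite -preimage_bigcup; exact: mE.
Qed.

HB.instance Definition _ := isMeasure.Build _ _ _ lebesgue_tuple_step
  step0 step_ge0 step_sigma_additive.

Let step_sigma_finite : sigma_finite setT lebesgue_tuple_step.
Proof.
have /sigma_finiteP[F [TF ndF Foo]] := sigma_finiteT (@lebesgue_measure R).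
have /sigma_finiteP[G [TG ndG Goo]] := sigma_finiteT mu.
have mhead : measurable_fun setT (@thead n RT) by exact: measurable_tnth.
have mtail : measurable_fun setT (@behead_tuple n.+1 RT).
  exact: measurable_behead.
exists (fun k => @thead n RT @^-1` F k `&` @behead_tuple n.+1 RT @^-1` G k).
  apply/esym/seteqP; split => // x _.
  have [k _ Fk] : (\bigcup_k F k) (thead x) by rewrite -TF.
  have [l _ Gl] : (\bigcup_k G k) (behead_tuple x) by rewrite -TG.
  exists (maxn k l) => //; split.
  - by apply: (subsetPset _ _ (ndF _ _ (leq_maxl k l))) Fk.
  - by apply: (subsetPset _ _ (ndG _ _ (leq_maxr k l))) Gl.
move=> k; have [mF Flt] := Foo k; have [mG Glt] := Goo k; split.
  apply: measurableI; rewrite -[X in measurable X]setTI.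
    exact: mhead.
  exact: mtail.
rewrite /lebesgue_tuple_step /pushforward.
rewrite (_ : _ @^-1` _ = F k `*` G k).
  by rewrite product_measure1E// lte_mul_pinfty// ge0_fin_numE.
have tailK (a : RT) (x : n.-tuple RT) : behead_tuple [tuple of a :: x] = x.
  exact: val_inj.
by apply/seteqP; split => -[a x]; rewrite /tuple_cons /= theadE tailK.
Qed.

HB.instance Definition _ := Measure_isSigmaFinite.Build _ _ _
  lebesgue_tuple_step step_sigma_finite.

End step.

(* Lebesgue measure on R^n, carried by the product sigma-algebra of [n.-tuple]:
   the n-fold product of the one-dimensional Lebesgue measure, through the
   identification of R * R^n with R^n.+1; R^0 is a point of mass 1. *)
Fixpoint lebesgue_tuple n : {sigma_finite_measure set (n.-tuple RT) -> \bar R} :=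
  if n is m.+1 then lebesgue_tuple_step (lebesgue_tuple m)
  else dirac [tuple].

End lebesgue_tuple.

Definition row_of_tuple (R : realType) n (x : n.-tuple (measurableTypeR R)) :
  'rV[R]_n := \row_i tnth x i.

Section smooth.
Context (R : realType) (V : normedModType R).

(* In finite dimension this is the usual class C^k. *)
Fixpoint Ck k (f : V -> R) : Prop :=
  if k is k'.+1 then (forall x, differentiable f x) /\ forall v, Ck k' ('D_v f)
  else continuous f.

Definition smooth (f : V -> R) := forall k, Ck k f.

Definition supp (f : V -> R) : set V := closure [set x | f x != 0].

(* Elements of C_0^oo(Q), Q open, identified with their extension by zero. *)
Definition test_function (Q : set V) (f : V -> R) :=
  [/\ smooth f, compact (supp f) & supp f `<=` Q].

End smooth.

(* Points of space-time are pairs (x, t); space is 'rV[R]_n.+1, so that its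
   first coordinate x_1 is [x 0 0]. The library norm on row vectors is the
   supremum norm, hence the explicit Euclidean norm. *)
Section space_time.
Context (R : realType) (n : nat).
Local Notation space := 'rV[R]_n.+1.
Local Notation spacetime := ('rV[R]_n.+1 * R)%type.

Definition enorm (x : space) : R := Num.sqrt (\sum_i x 0 i ^+ 2).

Definition cone (theta : R) : set space :=
  [set x : space | x 0 0 > enorm x * cos (theta / 2)].

Definition Qcone (theta : R) : set spacetime :=
  (cone theta `&` [set x : space | x 0 0 > 1]) `*` [set t : R | 0 < t < 1].

Definition dt (u : spacetime -> R) : spacetime -> R := 'D_(0, 1) u.

Definition dx (i : 'I_n.+1) (u : spacetime -> R) : spacetime -> R :=
  'D_(delta_mx 0 i, 0) u.

Definition grad (u : spacetime -> R) (z : spacetime) : space :=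
  \row_i dx i u z.

Definition laplacian (u : spacetime -> R) (z : spacetime) : R :=
  \sum_i dx i (dx i u) z.

Definition spacetime_integral (Q : set spacetime) (f : spacetime -> R) : \bar R :=
  (\int[lebesgue_tuple R n.+1 \x @lebesgue_measure R]_(z in
     [set z | Q (row_of_tuple z.1, z.2)]) (f (row_of_tuple z.1, z.2))%:E)%E.

End space_time.

Section weights.
Context (R : realType) (n : nat).

Definition Lam (alpha t : R) : R := (1 - t) / t `^ (alpha / 2).

Definition vphi (eps alpha : R) (x : 'rV[R]_n.+1) : R :=
  x 0 0 `^ alpha - eps `^ alpha * enorm x `^ alpha.

Definition phi (eps alpha a : R) (z : 'rV[R]_n.+1 * R) : R :=
  a * Lam alpha z.2 * vphi eps alpha z.1 + z.2 ^+ 2.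

End weights.

(* Main.v *)
(** Put [v = e^phi u] and split the conjugated operator
    [e^phi (dt + Lap) e^-phi v = (Lap v + H v) + (v_t - 2 grad phi . grad v + G v)],
    where [G = F - Lap phi], [H = |grad phi|^2 - phi_t - F] and [F] is free.
    Twice the product of the two brackets is, up to a divergence, a quadratic
    form [4 D^2 phi - 2 F] in [grad v] plus [K v^2]. The Hessian of
    [phi = a Lambda varphi + t^2] is bounded below by
    [- a Lambda alpha eps^alpha |x|^(alpha-2)], and taking [F] equal to twice
    this bound makes the form nonnegative. The price is paid in the leading part
    of [K], of order [a^3 Lambda^3], which stays positive in the cone when
    [alpha] is close to [2] because [3 eps^2 < 1]; the decay of [Lambda] and the
    constant [phi_tt >= 2] provide the rest, and the lower order terms are
    absorbed for large [a]. The gradient of [u] is recovered from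
    [|grad v|^2 = div (v grad v) - v Lap v]. *)
Require Import Defs.
From HB Require Import structures.
From mathcomp Require Import all_boot all_order all_algebra.
From mathcomp Require Import all_classical all_reals all_analysis.
From mathcomp Require Import measurable_realfun ring lra.

Set Implicit Arguments.
Unset Strict Implicit.
Unset Printing Implicit Defensive.

Import Order.TTheory GRing.Theory Num.Theory.
Import numFieldNormedType.Exports.

Local Open Scope classical_set_scope.
Local Open Scope ring_scope.

(** The constant 4 splits as 3 + 1. Three copies of the squared conjugated operator supply the
    squares of the two brackets and their cross product; the fourth, by completing the square with
    [v / 2], supplies [- v] times the operator, whose integration by parts yields exactly the one
    [|grad v|^2] that the left-hand side asks for. The shift [F] is free because it only moves mass
    from one bracket to the other. The obstacle is that [a0] must not depend on [u]: [K] has to be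
    bounded pointwise, uniformly up to [t = 0], where [Lambda] blows up, up to [t = 1], where it
    vanishes, and for large [|x|], where [|x|^(alpha-2)] decays. This succeeds because each harmful
    term that grows with [a] either carries [a Lambda], and is paid by a cubic in
    [a Lambda |x|^(alpha-2)] together with a term of order [a^2 Lambda |Lambda'|], or carries
    [a varphi], and is paid by [a Lambda'' varphi]. The weight is smooth only for [x_1 > 0] and
    [t > 0], so the calculus is relative to that open set; only products with [u] are treated on the
    whole space. *)

Section directional_derivatives.
Context (R : realType) (V : normedModType R).
Implicit Types (f g : V -> R) (z v w : V).

(** Pointwise [fun y =>] forms of the sum, opposite and product rules, the shapes on which the
    syntax-directed tactic [is_derive_rules] recurses. *)
Lemma is_deriveDl f g z v df dg : is_derive z v f df -> is_derive z v g dg ->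
  is_derive z v (fun y => f y + g y) (df + dg).
Proof. exact: is_deriveD. Qed.

Lemma is_deriveNl f z v df : is_derive z v f df ->
  is_derive z v (fun y => - f y) (- df).
Proof. exact: is_deriveN. Qed.

Lemma is_deriveMl f g z v df dg : is_derive z v f df -> is_derive z v g dg ->
  is_derive z v (fun y => f y * g y) (df * g z + f z * dg).
Proof.
move=> hf hg; have H : is_derive z v (fun y => f y * g y) _ := is_deriveM hf hg.
by apply: is_derive_eq H _; rewrite /GRing.scale/=; ring.
Qed.

Lemma is_derive_suml n (h : 'I_n -> V -> R) z v (dh : 'I_n -> R) :
  (forall i, is_derive z v (h i) (dh i)) ->
  is_derive z v (fun y => \sum_(i < n) h i y) (\sum_(i < n) dh i).
Proof.
move=> H; rewrite (_ : (fun y => _) = \sum_(i < n) h i); last first.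
  by apply/funext => y; rewrite fct_sumE.
exact: is_derive_sum.
Qed.

(** Restriction to the line through [z] gives access to the chain rule and the mean value theorem in
    one variable, with no appeal to total differentiability. *)
Lemma is_derive_line f z v df :
  is_derive z v f df <-> is_derive (0 : R) 1 (fun h : R => f (h *: v + z)) df.
Proof.
have E : 'D_v f z = 'D_1 (fun h : R => f (h *: v + z)) 0.
  rewrite /derive; set g1 := fun h => h^-1 *: _; set g2 := fun h => h^-1 *: _.
  suff -> : g1 = g2 by []; apply/funext => h; rewrite /g1 /g2 /=.
  by rewrite addr0 scale0r add0r [_%:A]mulr1.
split=> -[d e]; apply: DeriveDef.
- by move: d; rewrite derivable1P.
- by rewrite -E.
- by apply/derivable1P.
- by rewrite E.
Qed.

End directional_derivatives.

Section derivatives_along_lines.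
Context (R : realType) (V : normedModType R).
Implicit Types (f g : V -> R) (z v w : V).

Lemma is_derive_along f z v (s : R) df :
  is_derive (s *: v + z) v f df ->
  is_derive s 1 (fun h : R => f (h *: v + z)) df.
Proof.
move=> /is_derive_line H; apply/is_derive_line.
by under eq_fun do rewrite [_%:A]mulr1 scalerDl -addrA.
Qed.

Lemma is_derive_compl (h : R -> R) f z v df dh : is_derive z v f df ->
  is_derive (f z) 1 h dh -> is_derive z v (fun y => h (f y)) (dh * df).
Proof.
move=> /is_derive_line hf hh; apply/is_derive_line.
apply: (@is_derive1_comp R h (fun s : R => f (s *: v + z))) => //.
by rewrite scale0r add0r.
Qed.

Lemma is_derive_linear (f : {linear V -> R}) z v : continuous f ->
  is_derive z v f (f v).
Proof.
move=> cf; apply: DeriveDef; first exact/diff_derivable/linear_differentiable.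
by rewrite deriveE ?diff_lin//; exact: linear_differentiable.
Qed.

End derivatives_along_lines.

(** * Calculus of functions smooth on an open set *)

Section smooth_on.
Context (R : realType) (V : normedModType R) (U : set V).
Hypothesis oU : open U.
Implicit Types (f g : V -> R) (z v w : V).

(** Relative to [U], since the powers in the weight are regular only where [x_1 > 0] and [t > 0].
    Continuity is demanded at every order because derivability in all directions does not imply
    it. *)
Fixpoint CkOn k f : Prop :=
  (forall z, U z -> {for z, continuous f}) /\
  if k is k'.+1 then
    (forall v z, U z -> derivable f z v) /\ forall v, CkOn k' ('D_v f)
  else True.

Definition smoothOn f := forall k, CkOn k f.

Lemma CkOn_cont k f z : CkOn k f -> U z -> {for z, continuous f}.
Proof. by case: k => [|k] [+ _]; exact. Qed.

Lemma CkOnW k f : CkOn k.+1 f -> CkOn k f.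
Proof.
elim: k f => [|k ih] f [cf [df Df]]; first by split.
by split=> //; split=> // v; exact: ih.
Qed.

Lemma eqOn_near f g z : (forall y, U y -> f y = g y) -> U z ->
  \forall y \near z, f y = g y.
Proof.
move=> fg Uz; have : \near z, U z by exact: open_nbhs_nbhs.
by apply: filterS => y; exact: fg.
Qed.

Lemma eq_CkOn k f g : (forall z, U z -> f z = g z) -> CkOn k f -> CkOn k g.
Proof.
elim: k f g => [|k ih] f g fg.
  move=> [cf _]; split=> // z Uz.
  suff : g @ z --> f z by rewrite (fg _ Uz).
  apply: cvg_trans (cf z Uz); apply: near_eq_cvg.
  exact: eqOn_near.
move=> [cf [df Df]]; split; last split.
- move=> z Uz; suff : g @ z --> f z by rewrite (fg _ Uz).
  apply: cvg_trans (cf z Uz); apply: near_eq_cvg.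
  exact: eqOn_near.
- by move=> v z Uz; apply: near_eq_derivable (df v z Uz); exact: eqOn_near.
- move=> v; apply: ih (Df v) => z Uz; apply: near_eq_derive.
  exact: eqOn_near.
Qed.

Lemma smoothOn_eq f g : (forall z, U z -> f z = g z) -> smoothOn f -> smoothOn g.
Proof. by move=> fg sf k; apply: eq_CkOn fg (sf k). Qed.

Lemma CkOn_is_derive k f z v : CkOn k.+1 f -> U z -> is_derive z v f ('D_v f z).
Proof. by move=> [_ [df _]] Uz; apply: derivableP; exact: df. Qed.

Lemma smoothOn_is_derive f z v : smoothOn f -> U z ->
  is_derive z v f ('D_v f z).
Proof. by move=> sf Uz; exact: (@CkOn_is_derive 0 f z v (sf 1%N) Uz). Qed.

Lemma smoothOn_cont f z : smoothOn f -> U z -> {for z, continuous f}.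
Proof. by move=> sf Uz; exact: (@CkOn_cont 0 f z (sf 0%N) Uz). Qed.

Lemma smoothOn_derive f v : smoothOn f -> smoothOn ('D_v f).
Proof. by move=> sf k; have [_ [_]] := sf k.+1; exact. Qed.

(** The step shared by the closure rules: since [U] is open, a formula for the derivative that is
    valid on [U] only may stand for the derivative itself. *)
Lemma CkOnS k f (Df : V -> V -> R) :
  (forall z, U z -> {for z, continuous f}) ->
  (forall v z, U z -> is_derive z v f (Df v z)) -> (forall v, CkOn k (Df v)) ->
  CkOn k.+1 f.
Proof.
move=> cf df DD; split=> //; split=> [v z Uz|v].
  exact: (@ex_derive _ _ _ _ _ _ _ (df v z Uz)).
apply: eq_CkOn (DD v) => z Uz.
by rewrite (@derive_val _ _ _ _ _ _ _ (df v z Uz)).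
Qed.

Lemma CkOn_cst k (c : R) : CkOn k (fun=> c).
Proof.
elim: k c => [|k ih] c; first by split=> // z _; exact: cvg_cst.
apply: (@CkOnS _ _ (fun _ _ => 0)) => [z _|v].
  exact: cvg_cst.
exact: ih.
Qed.

Lemma CkOnD k f g : CkOn k f -> CkOn k g -> CkOn k (fun z => f z + g z).
Proof.
elim: k f g => [|k ih] f g hf hg.
  by split=> // z Uz; apply: cvgD; [exact: CkOn_cont hf _|exact: CkOn_cont hg _].
apply: (@CkOnS _ _ (fun v z => 'D_v f z + 'D_v g z)).
- by move=> z Uz; apply: cvgD; [exact: CkOn_cont hf _|exact: CkOn_cont hg _].
- by move=> v z Uz; apply: is_deriveDl;
    [exact: (CkOn_is_derive v hf)|exact: (CkOn_is_derive v hg)].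
- by move=> v; apply: ih; [exact: hf.2.2|exact: hg.2.2].
Qed.

Lemma CkOnM k f g : CkOn k f -> CkOn k g -> CkOn k (fun z => f z * g z).
Proof.
elim: k f g => [|k ih] f g hf hg.
  by split=> // z Uz; apply: cvgM; [exact: CkOn_cont hf _|exact: CkOn_cont hg _].
apply: (@CkOnS _ _ (fun v z => 'D_v f z * g z + f z * 'D_v g z)).
- by move=> z Uz; apply: cvgM; [exact: CkOn_cont hf _|exact: CkOn_cont hg _].
- by move=> v z Uz; apply: is_deriveMl;
    [exact: (CkOn_is_derive v hf)|exact: (CkOn_is_derive v hg)].
- move=> v; apply: CkOnD.
    by apply: ih; [exact: hf.2.2|exact: CkOnW].
  by apply: ih; [exact: CkOnW|exact: hg.2.2].
Qed.

Lemma CkOn_expR k f : CkOn k f -> CkOn k (fun z => expR (f z)).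
Proof.
elim: k f => [|k ih] f hf.
  split=> // z Uz; apply: continuous_comp; last exact: continuous_expR.
  exact: CkOn_cont hf _.
apply: (@CkOnS _ _ (fun v z => expR (f z) * 'D_v f z)).
- move=> z Uz; apply: continuous_comp; last exact: continuous_expR.
  exact: CkOn_cont hf _.
- move=> v z Uz; exact: (is_derive_compl (CkOn_is_derive v hf Uz) (is_derive_expR _)).
- move=> v; apply: CkOnM; last exact: hf.2.2.
  by apply: ih; exact: CkOnW.
Qed.

Lemma CkOnV k f : (forall z, U z -> f z != 0) -> CkOn k f ->
  CkOn k (fun z => (f z)^-1).
Proof.
move=> f0; elim: k => [|k ih] hf.
  split=> // z Uz; apply: cvgV; first exact: f0.
  exact: CkOn_cont hf _.
apply: (@CkOnS _ _ (fun v z => - ((f z)^-1 * (f z)^-1) * 'D_v f z)).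
- move=> z Uz; apply: cvgV; first exact: f0.
  exact: CkOn_cont hf _.
- move=> v z Uz; apply: (@is_derive_compl R V GRing.inv f).
    exact: (CkOn_is_derive v hf).
  apply: is_derive_eq.
    by apply: (@is_deriveV R id); exact: f0.
  by rewrite /GRing.scale /= mulr1 expr2 invfM.
- move=> v; apply: CkOnM; last exact: hf.2.2.
  rewrite (_ : (fun _ => _) = fun z => -1 * ((f z)^-1 * (f z)^-1)); last first.
    by apply/funext => z; rewrite mulN1r.
  apply: CkOnM; first exact: CkOn_cst.
  by apply: CkOnM; apply: ih; exact: CkOnW.
Qed.

Lemma CkOn_ln k f : (forall z, U z -> 0 < f z) -> CkOn k f ->
  CkOn k (fun z => ln (f z)).
Proof.
(* No induction: the derivative is the inverse of [f] times that of [f], already covered by the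
   rules for inverses and products. *)
move=> f0; case: k => [|k] hf.
  split=> // z Uz; apply: continuous_comp; first exact: CkOn_cont hf _.
  by apply: continuous_ln; exact: f0.
apply: (@CkOnS _ _ (fun v z => (f z)^-1 * 'D_v f z)).
- move=> z Uz; apply: continuous_comp; first exact: CkOn_cont hf _.
  by apply: continuous_ln; exact: f0.
- move=> v z Uz; apply: (@is_derive_compl R V (@ln R) f).
    exact: (CkOn_is_derive v hf).
  by apply: is_derive1_ln; exact: f0.
- move=> v; apply: CkOnM; last exact: hf.2.2.
  apply: CkOnV; last exact: CkOnW.
  by move=> z Uz; rewrite gt_eqF// f0.
Qed.

Lemma smoothOn_cst (c : R) : smoothOn (fun=> c).
Proof. by move=> k; exact: CkOn_cst. Qed.

Lemma smoothOnD f g : smoothOn f -> smoothOn g -> smoothOn (fun z => f z + g z).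
Proof. by move=> sf sg k; exact: CkOnD. Qed.

Lemma smoothOnM f g : smoothOn f -> smoothOn g -> smoothOn (fun z => f z * g z).
Proof. by move=> sf sg k; exact: CkOnM. Qed.

Lemma smoothOnN f : smoothOn f -> smoothOn (fun z => - f z).
Proof.
move=> sf; apply: (@smoothOn_eq (fun z => -1 * f z)).
  by move=> z _; rewrite mulN1r.
by apply: smoothOnM => //; exact: smoothOn_cst.
Qed.

Lemma smoothOnX f m : smoothOn f -> smoothOn (fun z => f z ^+ m).
Proof.
move=> sf; elim: m => [|m ih]; first exact: smoothOn_cst.
apply: (@smoothOn_eq (fun z => f z * f z ^+ m)).
  by move=> z _; rewrite exprS.
exact: smoothOnM.
Qed.

Lemma smoothOn_sum n (h : 'I_n -> V -> R) : (forall i, smoothOn (h i)) ->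
  smoothOn (fun z => \sum_(i < n) h i z).
Proof.
elim: n h => [|n ih] h sh.
  apply: (@smoothOn_eq (fun=> 0)); last exact: smoothOn_cst.
  by move=> z _; rewrite big_ord0.
apply: (@smoothOn_eq (fun z => \sum_(i < n) h (widen_ord (leqnSn n) i) z + h ord_max z)).
  by move=> z _; rewrite big_ord_recr.
by apply: smoothOnD => //; apply: ih.
Qed.

Lemma smoothOn_expR f : smoothOn f -> smoothOn (fun z => expR (f z)).
Proof. by move=> sf k; exact: CkOn_expR. Qed.

Lemma smoothOn_powR f (p : R) : (forall z, U z -> 0 < f z) -> smoothOn f ->
  smoothOn (fun z => f z `^ p).
Proof.
move=> f0 sf; apply: (@smoothOn_eq (fun z => expR (p * ln (f z)))).
  by move=> z Uz; rewrite /powR gt_eqF// f0.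
apply: smoothOn_expR; apply: smoothOnM; first exact: smoothOn_cst.
by move=> k; exact: CkOn_ln.
Qed.

Lemma smoothOn_linear (f : {linear V -> R}) : continuous f -> smoothOn f.
Proof.
move=> cf [|k]; first by split=> // z _; exact: cf.
apply: (@CkOnS _ _ (fun v _ => f v)).
- by move=> z _; exact: cf.
- by move=> v z _; exact: is_derive_linear.
- by move=> v; exact: CkOn_cst.
Qed.

Lemma smooth_smoothOn f : smooth f -> smoothOn f.
Proof.
move=> sf k; move: (sf k); elim: k f {sf} => [|k ih] f.
  by move=> cf; split=> // z _; exact: cf.
move=> /= [df Df]; split; last split.
- by move=> z _; apply: differentiable_continuous.
- by move=> v z _; apply: diff_derivable.
- by move=> v; exact: ih.
Qed.

End smooth_on.

(** * Symmetry of second derivatives *)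

Section mixed_derivatives.
Context (R : realType).

Lemma is_derive_MVT (g dg : R -> R) (a b : R) : a < b ->
  (forall x, x \in `[a, b] -> is_derive x 1 g (dg x)) ->
  exists2 c, c \in `]a, b[ & g b - g a = dg c * (b - a).
Proof.
move=> ab hg.
have hg' x : x \in `]a, b[ -> is_derive x 1 g (dg x).
  by move=> xab; apply: hg; exact: subset_itv_oo_cc xab.
apply: (MVT ab hg').
apply: continuous_in_subspaceT => x /[1!inE] xab.
have [+ _] := hg x xab.
move=> /derivable1_diffP.
exact: differentiable_continuous.
Qed.

Context (V : normedModType R) (U : set V) (oU : open U).

(** The mean value theorem twice: along [v] for the increment of [f] in direction [w], then along
    [w] for ['D_v f]. *)
Lemma second_difference (f : V -> R) (z v w : V) (h : R) : smoothOn U f ->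
  0 < h ->
  (forall s t, s \in `[0, h] -> t \in `[0, h] -> U (s *: v + (t *: w + z))) ->
  exists s t, [/\ s \in `[0, h], t \in `[0, h] &
    f (h *: v + (h *: w + z)) - f (h *: v + z) - (f (h *: w + z) - f z) =
    h ^+ 2 * 'D_w ('D_v f) (s *: v + (t *: w + z))].
Proof.
move=> sf h0 hU.
have in0 : 0 \in `[0, h] by rewrite in_itv /= lexx ltW.
have inh : h \in `[0, h] by rewrite in_itv /= lexx ltW.
have hU' s : s \in `[0, h] -> U (s *: v + z).
  by move=> sh; have := hU _ _ sh in0; rewrite scale0r add0r.
pose g s := f (s *: v + (h *: w + z)) - f (s *: v + z).
pose dg s := 'D_v f (s *: v + (h *: w + z)) - 'D_v f (s *: v + z).
have [s sh gE] : exists2 c, c \in `]0, h[ & g h - g 0 = dg c * (h - 0).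
  apply: (@is_derive_MVT g dg _ _ h0) => s sh; rewrite /g /dg; apply: is_deriveDl.
    by apply/is_derive_along/smoothOn_is_derive; [exact: sf|exact: hU].
  apply: is_deriveNl.
  by apply/is_derive_along/smoothOn_is_derive; [exact: sf|exact: hU'].
have sh' := subset_itv_oo_cc sh.
pose k t := 'D_v f (t *: w + (s *: v + z)).
pose dk t := 'D_w ('D_v f) (t *: w + (s *: v + z)).
have [t th kE] : exists2 c, c \in `]0, h[ & k h - k 0 = dk c * (h - 0).
  apply: (@is_derive_MVT k dk _ _ h0) => t th; rewrite /k /dk.
  apply: (@is_derive_along _ _ ('D_v f)); apply: smoothOn_is_derive.
    exact: smoothOn_derive sf.
  by rewrite addrCA; exact: hU.
exists s, t; split=> //; first exact: subset_itv_oo_cc th.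
move: gE; rewrite /g /dg !scale0r !add0r subr0 => ->.
move: kE; rewrite /k /dk !scale0r !add0r subr0 addrCA => ->.
by rewrite addrCA; ring.
Qed.

(** Schwarz's theorem: the second difference over a small parallelogram is symmetric in [v] and [w],
    so it is [h ^+ 2] times either mixed derivative at points near [z], where both are
    continuous. *)
Lemma derive_comm (f : V -> R) (z v w : V) : smoothOn U f -> U z ->
  'D_v ('D_w f) z = 'D_w ('D_v f) z.
Proof.
move=> sf Uz; apply/eqP; rewrite -subr_eq0 -normr_le0; apply/ler_addgt0Pl => e e0.
rewrite addr0.
have cvw : {for z, continuous ('D_v ('D_w f))}.
  by apply: (smoothOn_cont _ Uz); do 2 apply: smoothOn_derive.
have cwv : {for z, continuous ('D_w ('D_v f))}.
  by apply: (smoothOn_cont _ Uz); do 2 apply: smoothOn_derive.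
have e2 : 0 < e / 2 by rewrite divr_gt0.
have nU : \forall y \near z, U y by exact: open_nbhs_nbhs.
have nvw : \forall y \near z, `|'D_v ('D_w f) z - 'D_v ('D_w f) y| < e / 2.
  by have /cvgrPdist_lt := cvw; apply.
have nwv : \forall y \near z, `|'D_w ('D_v f) z - 'D_w ('D_v f) y| < e / 2.
  by have /cvgrPdist_lt := cwv; apply.
have : \forall y \near z, [/\ U y, `|'D_v ('D_w f) z - 'D_v ('D_w f) y| < e / 2 &
    `|'D_w ('D_v f) z - 'D_w ('D_v f) y| < e / 2].
  exact: filterS3 (fun y => And3 (P3 := _)) nU nvw nwv.
move=> /nbhs_ballP[r /= r0 rP].
(* This size keeps the parallelogram inside the ball of radius [r]; the [+ 1] guards against
   [v = w = 0]. *)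
pose h := r / (`|v| + `|w| + 1) / 2.
have M0 : 0 < `|v| + `|w| + 1 by rewrite ltr_wpDl// addr_ge0.
have h0 : 0 < h by rewrite /h !divr_gt0.
have near_z s t : s \in `[0, h] -> t \in `[0, h] ->
    ball z r (s *: v + (t *: w + z)).
  rewrite !in_itv /= => /andP[s0 sh] /andP[t0 th].
  rewrite -ball_normE /ball_ /= addrA opprD addrCA subrr addr0 normrN.
  apply: le_lt_trans (ler_normD _ _) _; rewrite !normrZ !ger0_norm//.
  have : h * (`|v| + `|w| + 1) < r.
    by rewrite /h mulrAC divfK ?gt_eqF// gtr_pMr// invf_lt1// ltr1n.
  have := ler_wpM2r (normr_ge0 v) sh; have := ler_wpM2r (normr_ge0 w) th.
  nra.
have [s [t [sh th E1]]] := second_difference sf h0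
  (fun s t hs ht => let: And3 Uy _ _ := rP _ (near_z s t hs ht) in Uy).
have sw s1 t1 : s1 \in `[0, h] -> t1 \in `[0, h] -> U (s1 *: w + (t1 *: v + z)).
  by move=> hs ht; rewrite addrCA; have [] := rP _ (near_z _ _ ht hs).
have [s' [t' [sh' th' E2]]] := second_difference sf h0 sw.
have [_ _ d1] := rP _ (near_z _ _ sh th).
have [_ d2 _] := rP _ (near_z _ _ th' sh').
rewrite [t' *: v + _]addrCA in d2.
have h20 : h ^+ 2 != 0 by rewrite expf_neq0// gt_eqF.
have E : 'D_w ('D_v f) (s *: v + (t *: w + z)) =
         'D_v ('D_w f) (s' *: w + (t' *: v + z)).
  apply: (mulfI h20); apply: etrans (esym E1) _; apply: etrans E2.
  by rewrite [h *: w + (h *: v + _)]addrCA; ring.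
rewrite -E in d2.
move: d1 d2; move: ('D_w ('D_v f) (s *: v + _)) => P d1 d2.
move: ('D_w _ z) ('D_v _ z) d1 d2 => A B d1 d2.
rewrite [e]splitr (_ : B - A = (B - P) - (A - P)); last by ring.
apply: ltW.
by apply: le_lt_trans (ler_normB _ _) _; exact: ltrD.
Qed.

End mixed_derivatives.

(** * Smooth functions that vanish off a closed subset of the domain *)

Section compactly_supported.
Context (R : realType) (V : normedModType R) (U K : set V).
Hypotheses (oU : open U) (cK : closed K) (KU : K `<=` U).
Implicit Types (f g : V -> R) (z v w : V).

(** Products of weights with [u] or its derivatives are of this kind. They are regular on the whole
    space, whatever the weights do outside [U], because they vanish near every point off [K]. *)
Definition smooth_supp f := smoothOn U f /\ forall z, ~ K z -> f z = 0.

Lemma smooth_supp_near0 f z : smooth_supp f -> ~ K z ->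
  \forall y \near z, cst 0 y = f y.
Proof.
move=> [_ f0] Kz; have : \near z, (~` K) z.
  by apply: open_nbhs_nbhs; split=> //; exact: closed_openC.
by apply: filterS => y /f0 ->.
Qed.

Lemma smooth_supp_derive f v : smooth_supp f -> smooth_supp ('D_v f).
Proof.
move=> sf; split; first exact: smoothOn_derive sf.1.
move=> z Kz; rewrite -(near_eq_derive v (smooth_supp_near0 sf Kz)).
exact: derive_cst.
Qed.

Lemma smooth_supp_is_derive f z v : smooth_supp f -> is_derive z v f ('D_v f z).
Proof.
move=> sf; have [Kz|Kz] := pselect (K z).
  exact: smoothOn_is_derive sf.1 (KU Kz).
rewrite (smooth_supp_derive v sf).2//.
by apply: near_eq_is_derive (smooth_supp_near0 sf Kz) _; exact: is_derive_cst.
Qed.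

Lemma smooth_supp_cont f : smooth_supp f -> continuous f.
Proof.
move=> sf z; have [Kz|Kz] := pselect (K z).
  exact: smoothOn_cont sf.1 (KU Kz).
suff : f @ z --> (0 : R) by rewrite -[X in _ --> X](sf.2 _ Kz).
apply: cvg_trans (@cvg_cst _ (0 : R) _ (nbhs z) _).
exact/near_eq_cvg/smooth_supp_near0.
Qed.

Lemma smooth_suppD f g : smooth_supp f -> smooth_supp g ->
  smooth_supp (fun z => f z + g z).
Proof.
move=> [sf f0] [sg g0]; split; first exact: smoothOnD.
by move=> z Kz; rewrite f0// g0// addr0.
Qed.

Lemma smooth_suppN f : smooth_supp f -> smooth_supp (fun z => - f z).
Proof.
move=> [sf f0]; split; first exact: smoothOnN.
by move=> z Kz; rewrite f0// oppr0.
Qed.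

Lemma smooth_suppM f g : smooth_supp f -> smoothOn U g ->
  smooth_supp (fun z => f z * g z).
Proof.
move=> [sf f0] sg; split; first exact: smoothOnM.
by move=> z Kz; rewrite f0// mul0r.
Qed.

Lemma smooth_suppMr f g : smooth_supp f -> smoothOn U g ->
  smooth_supp (fun z => g z * f z).
Proof.
move=> [sf f0] sg; split; first exact: smoothOnM.
by move=> z Kz; rewrite f0// mulr0.
Qed.

Lemma smooth_supp_sum n (h : 'I_n -> V -> R) : (forall i, smooth_supp (h i)) ->
  smooth_supp (fun z => \sum_(i < n) h i z).
Proof.
move=> sh; split; first by apply: smoothOn_sum => // i; exact: (sh i).1.
by move=> z Kz; rewrite big1// => i _; exact: (sh i).2.
Qed.

End compactly_supported.

(** * Measurability of continuous functions for the product sigma-algebra *)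

Section measurability.
Context (R : realType) (n : nat).
Local Notation RT := (measurableTypeR R).
Local Notation T := (n.-tuple RT * RT)%type.
Local Notation V := ('rV[R]_n * R)%type.

Definition to_row (z : T) : V := (row_of_tuple z.1, z.2).

(** The supremum norm makes a ball a product of intervals, one per coordinate. *)
Lemma measurable_to_row_ball (c : V) (e : R) : 0 < e ->
  measurable (to_row @^-1` (ball c e)).
Proof.
move=> e0; rewrite (_ : _ @^-1` _ =
   \bigcap_(i in [set: 'I_n]) ((fun z : T => tnth z.1 i) @^-1` (ball (c.1 0 i) e))
   `&` (snd @^-1` (ball c.2 e))); last first.
  apply/seteqP; split=> z /=.
    move=> [z1 z2]; split=> // i _.
    by have := z1.2 0 i; rewrite mxE.
  move=> [z1 z2]; split=> //; split=> // i j; rewrite ord1 mxE.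
  exact: z1.
apply: measurableI.
  apply: fin_bigcap_measurable => // i _.
  rewrite -[X in measurable X]setTI.
  apply: (@measurableT_comp _ _ _ _ _ _ (fun x : n.-tuple RT => tnth x i) _ fst) => //.
    exact: measurable_tnth.
  exact: measurable_ball.
rewrite -[X in measurable X]setTI.
by apply: measurable_snd => //; exact: measurable_ball.
Qed.

(** An open set is the union of the balls it contains with rational centre and radius [k.+1%:R^-1],
    a countable family; this ties the topology of row vectors to the sigma-algebra of tuples. *)
Lemma measurable_to_row_open (O : set V) : open O -> measurable (to_row @^-1` O).
Proof.
move=> oO.
pose ctr (p : 'rV[rat]_n * rat * nat) : V := (map_mx ratr p.1.1, ratr p.1.2).
pose rad (p : 'rV[rat]_n * rat * nat) : R := p.2.+1%:R^-1.
pose F p := to_row @^-1` [set z | ball (ctr p) (rad p) z /\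
  ball (ctr p) (rad p) `<=` O].
rewrite (_ : _ @^-1` O = \bigcup_p F p); last first.
  apply/seteqP; split=> z /=; last by move=> [p _ [zp]]; exact.
  move=> Oz; have : nbhs (to_row z) O by exact: open_nbhs_nbhs.
  move=> /nbhs_ballP[e /= e0 eO].
  (* With twice the radius below [e], a ball whose rational centre is that close to the point
     contains the point and stays in [O]. *)
  have [k _ /(_ _ (leqnn k)) /= ke] : \forall k \near \oo, k.+1%:R^-1 < e / 2.
    have e2 : 0 < e / 2 by rewrite divr_gt0.
    exact: near_infty_natSinv_lt (PosNum e2).
  have ratP (x : R) : exists q : rat, `|ratr q - x| < k.+1%:R^-1.
    have [|q] := @rat_in_itvoo R (x - k.+1%:R^-1) (x + k.+1%:R^-1).
      by rewrite ltrBlDr -addrA ltrDl addr_gt0.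
    by rewrite in_itv /= => qx; exists q; rewrite ltr_distl.
  pose q i := sval (cid (ratP (tnth z.1 i))).
  have qP i : `|ratr (q i) - tnth z.1 i| < k.+1%:R^-1 :> R by rewrite /q; case: cid.
  have [s sP] := ratP z.2.
  have zb : ball (ctr (\row_i q i, s, k)) (rad (\row_i q i, s, k)) (to_row z).
    split; rewrite /ctr /rad /=; last by rewrite -ball_normE.
    split=> // i j; rewrite ord1 !mxE.
    by rewrite -ball_normE; exact: qP.
  exists (\row_i q i, s, k) => //; split=> // y yb; apply: eO.
  apply: (le_ball (e1 := rad (\row_i q i, s, k) + rad (\row_i q i, s, k))).
    by rewrite /rad /= [e]splitr ltW// ltrD// ke /=.
  by apply: (ball_triangle (y := ctr (\row_i q i, s, k))) => //; exact: ball_sym.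
apply: countable_bigcupT_measurable => // p.
have [H|H] := pselect (ball (ctr p) (rad p) `<=` O).
  rewrite (_ : F p = to_row @^-1` ball (ctr p) (rad p)).
    by apply: measurable_to_row_ball; rewrite /rad.
  by apply/seteqP; split=> z /=; [case|].
rewrite (_ : F p = set0) //.
by apply/seteqP; split=> z //= [].
Qed.

Lemma measurable_to_row (f : V -> R) : continuous f ->
  measurable_fun setT (f \o to_row).
Proof.
move=> /continuousP cf _; apply: (measurability _ (RGenOpens.measurableE R)) => //.
move=> _ [_ [a [b ->] <-]]; rewrite setTI.
rewrite comp_preimage; apply: measurable_to_row_open.
exact/cf/interval_open.
Qed.

End measurability.

(** * Fubini on tuples and the fundamental theorem of calculus *)

Section integrability.
Local Open Scope ereal_scope.

Lemma bounded_integrable d (T : measurableType d) (R : realType)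
    (mu : {measure set T -> \bar R}) (B : set T) (f : T -> R) (M : R) :
  measurable B -> mu B < +oo -> measurable_fun setT f ->
  (forall x, (`|f x| <= M)%R) -> (forall x, ~ B x -> f x = 0%R) ->
  mu.-integrable setT (EFin \o f).
Proof.
move=> mB Boo mf fM f0.
apply: (@le_integrable _ _ _ mu setT measurableT (EFin \o f)
  (fun x => (M * \1_B x)%:E)).
- exact/measurable_EFinP.
- move=> x _; rewrite /= lee_fin indicE; have [xB|xB] := boolP (x \in B).
    by rewrite mulr1 (le_trans (fM x))// ler_norm.
  by rewrite f0 ?normr0// => /mem_set; exact/negP.
- under eq_fun do rewrite EFinM.
  apply: integrableZl => //; apply/integrableP; split.
    by apply/measurable_EFinP; exact: measurable_indic.
  under eq_integral do rewrite /= ger0_norm//.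
  by rewrite integral_indic// setIT.
Qed.

Context (R : realType).
Local Notation RT := (measurableTypeR R).

Definition box n (M : R) : set (n.-tuple RT) :=
  [set x | forall i, (`|tnth x i| <= M)%R].

Lemma measurable_box n M : measurable (@box n M).
Proof.
rewrite (_ : box M = \bigcap_(i in [set: 'I_n])
    ((fun x : n.-tuple RT => tnth x i) @^-1` `[(- M)%R, M])); last first.
  apply/seteqP; split=> x /= xM i => [_|]; rewrite /= ?in_itv /= ?ler_norml -?ler_norml.
    exact: xM.
  by have := xM i I; rewrite /= in_itv /= -ler_norml.
apply: fin_bigcap_measurable => // i _.
by rewrite -[X in measurable X]setTI; exact: measurable_tnth.
Qed.

Lemma tuple_cons_box n M :
  @tuple_cons R n @^-1` box M = `[(- M)%R, M]%classic `*` box M.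
Proof.
apply/seteqP; split=> -[a x] /=.
  move=> H; split=> [|i] /=.
    by rewrite in_itv /= -ler_norml; have := H ord0; rewrite (tnth_nth 0%R).
  by have := H (lift ord0 i); rewrite tnthS.
rewrite in_itv /= -ler_norml => -[aM xM] i.
case: (unliftP ord0 i) => [j ->|->]; first by rewrite tnthS; exact: xM.
by rewrite (tnth_nth 0%R).
Qed.

Lemma lebesgue_box n M : lebesgue_tuple R n (box M) < +oo.
Proof.
elim: n => [|n ih] /=.
  by rewrite diracE; exact: ltry.
rewrite /lebesgue_tuple_step /pushforward tuple_cons_box product_measure1E//.
  apply: lte_mul_pinfty => //.
  have H : @lebesgue_measure R `[(- M)%R, M]%classic < +oo.
    by rewrite lebesgue_measure_itv /=; case: ifPn => // _; exact: ltry.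
  by rewrite ge0_fin_numE.
exact: measurable_box.
Qed.

Definition tuple_upd n (x : n.-tuple RT) (i : 'I_n) (s : R) : n.-tuple RT :=
  [tuple if j == i then s else tnth x j | j < n].

Lemma tuple_upd0 n (y : n.-tuple RT) (a s : R) :
  tuple_upd (tuple_cons (a, y)) ord0 s = tuple_cons (s, y).
Proof.
apply: eq_from_tnth => j; rewrite tnth_mktuple.
by case: (unliftP ord0 j) => [k ->|->]; rewrite /tuple_cons /= ?tnthS ?(tnth_nth 0%R).
Qed.

Lemma tuple_upd_lift n (y : n.-tuple RT) (i : 'I_n) (a s : R) :
  tuple_upd (tuple_cons (a, y)) (lift ord0 i) s = tuple_cons (a, tuple_upd y i s).
Proof.
apply: eq_from_tnth => j; rewrite tnth_mktuple.
case: (unliftP ord0 j) => [k ->|->]; last by rewrite /tuple_cons /= !(tnth_nth 0%R).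
by rewrite (inj_eq lift_inj) /tuple_cons /= !tnthS tnth_mktuple.
Qed.

(** Fubini with variable [i] innermost, by induction along the recursive definition of the measure:
    the head is integrated first if it is variable [i], last otherwise. Boundedness and support in a
    box pass to slices, which secures integrability at each stage. *)
Lemma integral_lebesgue_tuple0 n (h : n.-tuple RT -> R) (M C : R) (i : 'I_n) :
  measurable_fun setT h -> (forall x, (`|h x| <= C)%R) ->
  (forall x, ~ box M x -> h x = 0%R) ->
  (forall x, \int[@lebesgue_measure R]_s (h (tuple_upd x i s))%:E = 0) ->
  \int[lebesgue_tuple R n]_x (h x)%:E = 0.
Proof.
elim: n h i => [|n ih] h i mh hC h0 hi; first by case: i {hi}.
have mhc : measurable_fun setT (h \o @tuple_cons R n).
  by apply: measurableT_comp => //; exact: measurable_tuple_cons.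
have mB : measurable ((`[(- M)%R, M]%classic : set RT) `*` @box n M).
  by apply: measurableX => //; exact: measurable_box.
have ihc : (@lebesgue_measure R \x lebesgue_tuple R n).-integrable setT
    (EFin \o (h \o @tuple_cons R n)).
  apply: (@bounded_integrable _ _ _ _ _ _ C mB).
  - have := @lebesgue_box n.+1 M.
    by rewrite /= /lebesgue_tuple_step /pushforward tuple_cons_box.
  - exact: mhc.
  - by move=> p; exact: hC.
  - by move=> p pB; apply: h0 => pM; apply: pB; rewrite -tuple_cons_box.
apply: (@etrans _ _
    (\int[@lebesgue_measure R \x lebesgue_tuple R n]_p (h (tuple_cons p))%:E)).
  rewrite /= integral_pushforward//.
  - exact: measurable_tuple_cons.
  - exact/measurable_EFinP.
case: (unliftP ord0 i) hi => [j ->|->] hi.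
  rewrite -integral12_prod_meas1//= /fubini_F; apply: integral0_eq => a _.
  apply: (ih (fun y => h (tuple_cons (a, y))) j).
  - by apply: measurableT_comp mhc _; exact: measurable_pair1.
  - by move=> y; exact: hC.
  - move=> y yB; apply: h0 => H; apply: yB.
    by have : (@tuple_cons R n @^-1` box M) (a, y) := H; rewrite tuple_cons_box => -[].
  - by move=> y; under eq_integral do rewrite -tuple_upd_lift; exact: hi.
rewrite -integral21_prod_meas1//= /fubini_G; apply: integral0_eq => y _.
by under eq_integral do rewrite -(tuple_upd0 y 0); exact: hi.
Qed.

Lemma integral_derive_line (f df : R -> R) (M : R) :
  (forall s : R, is_derive s (1%R : R) f (df s)) -> continuous df ->
  (forall s, ((M < `|s|) -> f s = 0)%R) ->
  \int[@lebesgue_measure R]_s (df s)%:E = 0.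
Proof.
move=> fdf cdf f0.
have cf : continuous f.
  by move=> s; apply: differentiable_continuous; apply/derivable1_diffP.
(* Positive and above [M] even if [M] is negative, so [f] vanishes at both ends of [[- A, A]]. *)
pose A := (`|M| + 1)%R.
have A0 : (- A < A)%R by rewrite /A; have := normr_ge0 M; lra.
have MA s : (A <= `|s|)%R -> f s = 0%R.
  by move=> H; apply: f0; rewrite /A in H; have := ler_norm M; lra.
have df0 s : ~ `[(- A)%R, A]%classic s -> df s = 0%R.
  rewrite /= in_itv /= => sA.
  have As : (A < `|s|)%R by rewrite ltNge; apply/negP; rewrite ler_norml => /sA.
  rewrite -(@derive_val _ _ _ _ _ _ _ (fdf s)).
  rewrite -[RHS](derive_cst (0%R : R) s (1%R : R)); apply: near_eq_derive.
  have : \forall t \near s, (A < `|t|)%R.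
    by have /cvgr_gt/(_ _ As) := @norm_continuous R R^o s.
  by apply: filterS => t At; rewrite MA// ltW.
rewrite (_ : (fun s => (df s)%:E) = (EFin \o df) \_ `[(- A)%R, A]); last first.
  apply/funext => s; rewrite patchE; case: ifPn => //.
  by rewrite notin_setE => /df0 /= ->.
rewrite -integral_mkcond (@continuous_FTC2 _ df f)//.
- by rewrite !MA ?subee// ?normrN /A; rewrite ler_norm.
- exact: continuous_subspaceT.
- split=> [s _||]; first exact: ex_derive.
    by apply: cvg_at_right_filter; exact: cf.
  by apply: cvg_at_left_filter; exact: cf.
- by move=> s _; rewrite derive1E derive_val.
Qed.

End integrability.

(** * The divergence theorem without boundary terms *)

Section spacetime_integrals.
Context (R : realType) (n : nat).
Local Notation RT := (measurableTypeR R).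
Local Notation V := ('rV[R]_n * R)%type.
Local Notation lebesgue_st := (lebesgue_tuple R n \x @lebesgue_measure R)%E.
Context (U K : set V).
Hypotheses (oU : open U) (cK : compact K) (KU : K `<=` U).

Lemma compact_spacetime_box : exists M : R,
  forall z, K z -> (forall i, `|z.1 0 i| <= M) /\ `|z.2| <= M.
Proof.
have [M [_ /(_ (M + 1))]] := compact_bounded cK.
rewrite ltrDl ltr01 => /(_ isT) HM; exists (M + 1) => z /HM /=.
rewrite prod_normE ge_max => /andP[h1 h2]; split=> // i.
apply: le_trans h1; rewrite [leRHS]/Num.norm /= mx_normrE.
by apply: (le_bigmax _ (fun ij => `|z.1 ij.1 ij.2|) (0, i)).
Qed.

Lemma continuous_supp_bounded (f : V -> R) : continuous f ->
  (forall z, ~ K z -> f z = 0) -> exists C : R, forall z, `|f z| <= C.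
Proof.
move=> cf f0.
have /compact_bounded[C [_ /(_ (`|C| + 1))]] : compact (f @` K).
  by apply: continuous_compact => //; exact: continuous_subspaceT.
rewrite ltr_pwDr// ?ler_norm// => /(_ isT) HC; exists (`|C| + 1) => z.
have [Kz|Kz] := pselect (K z); first by apply: HC; exists z.
by rewrite f0// normr0 addr_ge0.
Qed.

Lemma integrable_supp (f : V -> R) : continuous f ->
  (forall z, ~ K z -> f z = 0) ->
  lebesgue_st.-integrable setT (EFin \o (f \o @to_row R n)).
Proof.
move=> cf f0; have [M HM] := compact_spacetime_box.
have [C HC] := continuous_supp_bounded cf f0.
have mI : measurable (`[- M, M]%classic : set RT) by [].
have Moo : (@lebesgue_measure R `[(- M)%R, M]%classic < +oo)%E.
  by rewrite lebesgue_measure_itv /=; case: ifPn => // _; exact: ltry.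
apply: (@bounded_integrable _ _ _ _ (box M `*` (`[- M, M]%classic : set RT)) _ C).
- by apply: measurableX => //; exact: measurable_box.
- have E := product_measure1E (lebesgue_tuple R n) (@lebesgue_measure R)
    (measurable_box M) mI.
  rewrite [ltLHS]E.
  apply: lte_mul_pinfty => //; first by rewrite ge0_fin_numE// lebesgue_box.
- exact: measurable_to_row.
- by move=> z; exact: HC.
- move=> z zB; apply: f0 => /HM /= [h1 h2]; apply: zB; split=> /=.
    by move=> i; have := h1 i; rewrite mxE.
  by rewrite in_itv /= -ler_norml.
Qed.

Local Notation smooth_supp := (smooth_supp U K).

Let clK : closed K. Proof. by apply: compact_closed => //; exact: norm_hausdorff. Qed.

(** Fubini with time innermost: on each line parallel to the time axis the inner integral is that of
    a derivative with bounded support. *)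
Lemma integral_derive_t (f : V -> R) : smooth_supp f ->
  (\int[lebesgue_st]_z ('D_(0, 1) f (@to_row R n z))%:E = 0)%E.
Proof.
move=> sf; have sdf := smooth_supp_derive clK (0, 1) sf.
have [M HM] := compact_spacetime_box.
have idf : lebesgue_st.-integrable setT
    (EFin \o ('D_(0, 1) f \o @to_row R n)).
  by apply: integrable_supp; [exact: smooth_supp_cont sdf|exact: sdf.2].
rewrite -integral12_prod_meas1//.
apply: integral0_eq => x _; rewrite /fubini_F /to_row /=.
have zE s : (row_of_tuple x, s) = s *: ((0, 1) : V) + (row_of_tuple x, 0).
  by congr (_, _) => /=; rewrite ?scaler0 ?add0r ?addr0// [_%:A]mulr1.
apply: (@integral_derive_line _ (fun s => f (row_of_tuple x, s))
  (fun s : R => 'D_(0, 1) f (row_of_tuple x, s)) M).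
- move=> s; have : is_derive (s *: ((0, 1) : V) + (row_of_tuple x, 0)) (0, 1) f
      ('D_(0, 1) f (row_of_tuple x, s)).
    by rewrite -zE; exact: smooth_supp_is_derive sf.
  by move=> /is_derive_along; under eq_fun do rewrite -zE.
- under eq_fun do rewrite zE.
  move=> s; apply: (@continuous_comp _ _ _ (fun s : R =>
    s *: ((0, 1) : V) + (row_of_tuple x, 0)) ('D_(0, 1) f)).
    by apply: cvgD; [exact: scalel_continuous|exact: cvg_cst].
  exact: (smooth_supp_cont clK KU sdf).
- move=> s sM; apply: sf.2 => /HM [_ /=].
  by rewrite leNgt sM.
Qed.

Lemma integral_derive_x (f : V -> R) (i : 'I_n) : smooth_supp f ->
  (\int[lebesgue_st]_z ('D_(delta_mx 0 i, 0) f (@to_row R n z))%:E = 0)%E.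
Proof.
move=> sf; have sdf := smooth_supp_derive clK (delta_mx 0 i, 0) sf.
have [M HM] := compact_spacetime_box.
have [C HC] := continuous_supp_bounded (smooth_supp_cont clK KU sdf) sdf.2.
have idf : lebesgue_st.-integrable setT
    (EFin \o ('D_(delta_mx 0 i, 0) f \o @to_row R n)).
  by apply: integrable_supp; [exact: smooth_supp_cont sdf|exact: sdf.2].
rewrite -integral21_prod_meas1//.
apply: integral0_eq => t _; rewrite /fubini_G /to_row /=.
apply: (@integral_lebesgue_tuple0 _ _ _ M C i).
- have mf := measurable_to_row (smooth_supp_cont clK KU sdf).
  apply: (@measurableT_comp _ _ _ _ _ _ ('D_(delta_mx 0 i, 0) f \o @to_row R n) _
    (fun y : n.-tuple RT => (y, t : RT)) mf).
  exact: measurable_pair2.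
- by move=> x; exact: HC.
- move=> x xM; apply: sdf.2 => /HM /= [h _]; apply: xM => j.
  by have := h j; rewrite mxE.
move=> x.
(* The line along axis [i] is based at the point whose coordinate [i] is reset to [0]. *)
have zE s : (row_of_tuple (tuple_upd x i s), t) =
    s *: ((delta_mx 0 i, 0) : V) + (row_of_tuple (tuple_upd x i 0), t).
  congr (_, _) => /=; last by rewrite scaler0 add0r.
  apply/rowP => j; rewrite !mxE /= !tnth_mktuple.
  by case: (j == i); rewrite ?mulr1 ?addr0 ?mulr0 ?add0r.
apply: (@integral_derive_line _ (fun s => f (row_of_tuple (tuple_upd x i s), t))
  (fun s : R => 'D_(delta_mx 0 i, 0) f (row_of_tuple (tuple_upd x i s), t)) M).
- move=> s; have : is_derive
      (s *: ((delta_mx 0 i, 0) : V) + (row_of_tuple (tuple_upd x i 0), t))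
      (delta_mx 0 i, 0) f
      ('D_(delta_mx 0 i, 0) f (row_of_tuple (tuple_upd x i s), t)).
    by rewrite -zE; exact: smooth_supp_is_derive sf.
  by move=> /is_derive_along; under eq_fun do rewrite -zE.
- under eq_fun do rewrite zE.
  move=> s; apply: (@continuous_comp _ _ _ (fun s : R =>
    s *: ((delta_mx 0 i, 0) : V) + (row_of_tuple (tuple_upd x i 0), t))
    ('D_(delta_mx 0 i, 0) f)).
    by apply: cvgD; [exact: scalel_continuous|exact: cvg_cst].
  exact: (smooth_supp_cont clK KU sdf).
- move=> s sM; apply: sf.2 => /HM /= [/(_ i) + _].
  by rewrite mxE tnth_mktuple eqxx leNgt sM.
Qed.

End spacetime_integrals.

(** Structural differentiation with the value left open; atoms are looked up among the hypotheses,
    and [ring] or [field] then matches the result with the wanted closed form. *)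
Ltac is_derive_rules :=
  match goal with
  | |- is_derive _ _ (fun y => @?f y + @?g y) _ =>
      eapply (is_deriveDl (f := f) (g := g)); is_derive_rules
  | |- is_derive _ _ (fun y => - @?f y) _ =>
      eapply (is_deriveNl (f := f)); is_derive_rules
  | |- is_derive _ _ (fun y => @?f y * @?g y) _ =>
      eapply (is_deriveMl (f := f) (g := g)); is_derive_rules
  | |- is_derive _ _ (fun y => \sum_(i < _) @?h y i) _ =>
      eapply (is_derive_suml (h := fun i y => h y i)); intro; cbv beta; is_derive_rules
  | |- is_derive _ _ (fun y => ?c) _ => eapply is_derive_cst
  | _ => first [eassumption | match goal with H : forall _, _ |- _ => solve [eapply H] end]
  end.

(** * Algebra of the conjugated operator at one point *)

Section carleman_identity.
Context (R : realType) (V : normedModType R) (N : nat).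
Context (e : 'I_N -> V) (e_t z : V).
Variables (v vt G H ft F : V -> R) (vx fx gx : 'I_N -> V -> R).
Variables (vxx fxx : 'I_N -> 'I_N -> R) (vxt hx gxx : 'I_N -> R) (Ht : R).
Hypotheses (v_x : forall i, is_derive z (e i) v (vx i z))
  (v_t : is_derive z e_t v (vt z))
  (vt_x : forall i, is_derive z (e i) vt (vxt i))
  (vx_t : forall i, is_derive z e_t (vx i) (vxt i))
  (vx_x : forall i j, is_derive z (e i) (vx j) (vxx i j))
  (fx_x : forall i j, is_derive z (e i) (fx j) (fxx i j))
  (G_x : forall i, is_derive z (e i) G (gx i z))
  (gx_x : forall i, is_derive z (e i) (gx i) (gxx i))
  (H_x : forall i, is_derive z (e i) H (hx i))
  (H_t : is_derive z e_t H Ht).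

(* The two fluxes collect the boundary terms of the integrations by parts: their
   divergence is the integrated part of six times the product of the brackets
   [Lap v + H v] and [v_t - 2 grad f . grad v + G v], together with the terms
   that turn the [|grad v|^2] of the left-hand side into [v] times both. *)
Definition flux_t (y : V) : R :=
  - 3 * (\sum_(j < N) vx j y * vx j y) + 3 * (H y * (v y * v y)) -
  2^-1 * (v y * v y).

Definition flux_x (i : 'I_N) (y : V) : R :=
  6 * (vx i y * vt y) - 12 * (vx i y * (\sum_(j < N) fx j y * vx j y)) +
  6 * ((\sum_(j < N) vx j y * vx j y) * fx i y) + 6 * (G y * (v y * vx i y)) -
  3 * (v y * v y * gx i y) - 6 * (H y * (fx i y * (v y * v y))) -
  v y * vx i y + 2 * (v y * v y * fx i y).

Lemma is_derive_flux_t : is_derive z e_t flux_t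
  (- 6 * (\sum_(j < N) vx j z * vxt j) + 3 * (Ht * (v z * v z)) +
   6 * (H z * (v z * vt z)) - v z * vt z).
Proof.
rewrite /flux_t; eapply is_derive_eq; first is_derive_rules.
rewrite /= (_ : \sum_(i < N) (vxt i * vx i z + vx i z * vxt i) =
    2 * \sum_(j < N) vx j z * vxt j); first by field.
by rewrite mulr_sumr; apply: eq_bigr => j _; ring.
Qed.

Lemma is_derive_flux_x i : is_derive z (e i) (flux_x i)
  (6 * (vxx i i * vt z + vx i z * vxt i) -
   12 * (vxx i i * (\sum_(j < N) fx j z * vx j z) +
     vx i z * (\sum_(j < N) fxx i j * vx j z) +
     vx i z * (\sum_(j < N) fx j z * vxx i j)) +
   6 * (2 * (fx i z * (\sum_(j < N) vx j z * vxx i j)) +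
     (\sum_(j < N) vx j z * vx j z) * fxx i i) +
   6 * (gx i z * (v z * vx i z) + G z * (vx i z * vx i z + v z * vxx i i)) -
   3 * (2 * (v z * vx i z * gx i z) + v z * v z * gxx i) -
   6 * (hx i * fx i z * (v z * v z) +
     H z * (fxx i i * (v z * v z) + 2 * (fx i z * (v z * vx i z)))) -
   (vx i z * vx i z + v z * vxx i i) +
   2 * (2 * (v z * vx i z * fx i z) + v z * v z * fxx i i)).
Proof.
rewrite /flux_x; eapply is_derive_eq; first is_derive_rules.
rewrite /= (_ : \sum_(j < N) (vxx i j * vx j z + vx j z * vxx i j) =
    2 * \sum_(j < N) vx j z * vxx i j); last first.
  by rewrite mulr_sumr; apply: eq_bigr => j _; ring.
rewrite (_ : \sum_(j < N) (fxx i j * vx j z + fx j z * vxx i j) =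
    \sum_(j < N) fxx i j * vx j z + \sum_(j < N) fx j z * vxx i j); last first.
  by rewrite -big_split.
move: (\sum_(j < N) _) (\sum_(j < N) _) (\sum_(j < N) _) (\sum_(j < N) _) (\sum_(j < N) _).
by move=> s1 s2 s3 s4 s5; ring.
Qed.

Hypotheses (vxx_sym : forall i j, vxx i j = vxx j i).
Let lapv := \sum_(i < N) vxx i i.
Let lapf := \sum_(i < N) fxx i i.
Let vv := \sum_(i < N) vx i z * vx i z.
Let ff := \sum_(i < N) fx i z * fx i z.
Let fv := \sum_(i < N) fx i z * vx i z.

(** [M] and [L] stand for [grad f . grad v] and [|grad v|^2], frozen as scalars so that the sum over
    [i] is linear in what remains. *)
Let sum_flux_x (M L : R) : \sum_(i < N) (6 * (vxx i i * vt z + vx i z * vxt i) -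
   12 * (vxx i i * M + vx i z * (\sum_(j < N) fxx i j * vx j z) +
     vx i z * (\sum_(j < N) fx j z * vxx i j)) +
   6 * (2 * (fx i z * (\sum_(j < N) vx j z * vxx i j)) + L * fxx i i) +
   6 * (gx i z * (v z * vx i z) + G z * (vx i z * vx i z + v z * vxx i i)) -
   3 * (2 * (v z * vx i z * gx i z) + v z * v z * gxx i) -
   6 * (hx i * fx i z * (v z * v z) +
     H z * (fxx i i * (v z * v z) + 2 * (fx i z * (v z * vx i z)))) -
   (vx i z * vx i z + v z * vxx i i) +
   2 * (2 * (v z * vx i z * fx i z) + v z * v z * fxx i i)) =
  (6 * vt z - 12 * M + 6 * G z * v z - v z) * lapv +
  6 * (\sum_(i < N) vx i z * vxt i) -
  12 * (\sum_(i < N) vx i z * (\sum_(j < N) fxx i j * vx j z)) -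
  12 * (\sum_(i < N) vx i z * (\sum_(j < N) fx j z * vxx i j)) +
  12 * (\sum_(i < N) fx i z * (\sum_(j < N) vx j z * vxx i j)) +
  (6 * L - 6 * H z * v z ^+ 2 + 2 * v z ^+ 2) * lapf + (6 * G z - 1) * vv -
  3 * v z ^+ 2 * (\sum_(i < N) gxx i) -
  6 * v z ^+ 2 * (\sum_(i < N) hx i * fx i z) +
  (4 * v z - 12 * H z * v z) * fv.
Proof.
pose b i := \sum_(j < N) fxx i j * vx j z.
pose c i := \sum_(j < N) fx j z * vxx i j.
pose d i := \sum_(j < N) vx j z * vxx i j.
under eq_bigr => i _ do rewrite -/(b i) -/(c i) -/(d i).
under [X in _ - 12 * X - _]eq_bigr => i _ do rewrite -/(b i).
under [X in _ - 12 * X + 12 * _]eq_bigr => i _ do rewrite -/(c i).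
under [X in _ + 12 * X + _]eq_bigr => i _ do rewrite -/(d i).
rewrite /lapv /lapf /vv /fv !mulr_sumr -!sumrN -!big_split /=.
apply: eq_bigr => i _; move: (b i) (c i) (d i) => bi ci di; ring.
Qed.

(** Three copies of the square give the first two squares and six times the cross product; the
    fourth gives the third square, minus [v] times the operator, minus [v ^+ 2 / 4], hence the
    [4^-1]. The subtracted parenthesis is [e^(2f) (p u^2 + |grad u|^2)] written in [v]; its
    [|grad v|^2] cancels that of the fourth copy. *)
Lemma carleman_identity (p : R) :
  F z = G z + lapf -> H z = ff - ft z - F z ->
  4 * (lapv + vt z - 2 * fv + (ff - ft z - lapf) * v z) ^+ 2 -
  (vv - 2 * (v z * fv) + (ff + p) * v z ^+ 2) =
  3 * (lapv + H z * v z) ^+ 2 + 3 * (vt z - 2 * fv + G z * v z) ^+ 2 +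
  (lapv + vt z - 2 * fv + (ff - ft z - lapf) * v z + v z / 2) ^+ 2 +
  ('D_e_t flux_t z + \sum_(i < N) 'D_(e i) (flux_x i) z) +
  3 * (4 * (\sum_(i < N) \sum_(j < N) fxx i j * vx i z * vx j z) - 2 * F z * vv) +
  (3 * (\sum_(i < N) gxx i - Ht + 2 * (\sum_(i < N) hx i * fx i z) +
        2 * H z * F z) -
   (2 * ff + lapf - ft z + p + 4^-1)) * v z ^+ 2.
Proof.
move=> FE HE.
rewrite (@derive_val _ _ _ _ _ _ _ is_derive_flux_t).
under [X in _ = _ + (_ + X) + _ + _]eq_bigr => i _
  do rewrite (@derive_val _ _ _ _ _ _ _ (is_derive_flux_x i)).
rewrite sum_flux_x -/fv -/vv.
(* Symmetry of the Hessian of [v] makes the second derivatives coming from [(grad f . grad v) v_i]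
   cancel those coming from [|grad v|^2 f_i]. *)
have -> : \sum_(i < N) vx i z * (\sum_(j < N) fx j z * vxx i j) =
    \sum_(i < N) fx i z * (\sum_(j < N) vx j z * vxx i j).
  under eq_bigr do rewrite mulr_sumr.
  under [RHS]eq_bigr do rewrite mulr_sumr.
  rewrite exchange_big /=; apply: eq_bigr => i _; apply: eq_bigr => j _.
  by rewrite (vxx_sym j i); ring.
have -> : \sum_(i < N) \sum_(j < N) fxx i j * vx i z * vx j z =
    \sum_(i < N) vx i z * (\sum_(j < N) fxx i j * vx j z).
  apply: eq_bigr => i _; rewrite mulr_sumr; apply: eq_bigr => j _; ring.
rewrite HE FE.
move: (\sum_(i < N) vx i z * _) (\sum_(i < N) fx i z * _) => s1 s2.
move: (\sum_(i < N) gxx i) (\sum_(i < N) hx i * fx i z) => s3 s4.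
move: (\sum_(i < N) vx i z * vxt i) lapv lapf vv ff fv => s5 s6 s7 s8 s9 s10.
by field.
Qed.

End carleman_identity.

Ltac smooth_rules oU :=
  first [eassumption | match goal with H : forall _, _ |- _ => solve [eapply H] end |
  lazymatch goal with
  | |- smooth_supp _ _ (fun y => @?A y + @?B y) =>
      eapply (smooth_suppD oU (f := A) (g := B)); smooth_rules oU
  | |- smooth_supp _ _ (fun y => - @?A y) =>
      eapply (smooth_suppN oU (f := A)); smooth_rules oU
  | |- smooth_supp _ _ (fun y => @?A y * @?B y) =>
      first [solve [eapply (smooth_suppMr oU (f := B) (g := A)); smooth_rules oU]
            |solve [eapply (smooth_suppM oU (f := A) (g := B)); smooth_rules oU]]
  | |- smooth_supp _ _ (fun y => \sum_(i < _) @?A y i) =>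
      eapply (smooth_supp_sum oU (h := fun i y => A y i)); intro; cbv beta;
      smooth_rules oU
  | |- smoothOn _ (fun y => @?A y + @?B y) =>
      eapply (smoothOnD oU (f := A) (g := B)); smooth_rules oU
  | |- smoothOn _ (fun y => - @?A y) =>
      eapply (smoothOnN oU (f := A)); smooth_rules oU
  | |- smoothOn _ (fun y => @?A y * @?B y) =>
      eapply (smoothOnM oU (f := A) (g := B)); smooth_rules oU
  | |- smoothOn _ (fun y => @?A y ^+ _) =>
      eapply (smoothOnX oU (f := A)); smooth_rules oU
  | |- smoothOn _ (fun y => \sum_(i < _) @?A y i) =>
      eapply (smoothOn_sum oU (h := fun i y => A y i)); intro; cbv beta;
      smooth_rules oU
  | |- smoothOn _ (fun y => expR (@?A y)) =>
      eapply (smoothOn_expR oU (f := A)); smooth_rules oU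
  | |- smoothOn _ (fun y => derive ?A y ?w) =>
      eapply (smoothOn_derive (f := A) w); smooth_rules oU
  | |- smooth_supp _ _ (fun y => derive ?A y ?w) =>
      match goal with H : closed _ |- _ =>
        eapply (smooth_supp_derive H (f := A) w) end; smooth_rules oU
  | |- smoothOn _ (fun y => ?A) => exact (smoothOn_cst oU A)
  end].

(** * From pointwise positivity to the weighted integral inequality *)

Section weighted_estimate.
Context (R : realType) (n : nat).
Local Notation V := ('rV[R]_n * R)%type.
Local Notation lebesgue_st := (lebesgue_tuple R n \x @lebesgue_measure R)%E.
Context (U K : set V).
Hypotheses (oU : open U) (cK : compact K) (KU : K `<=` U).
Local Notation smooth_supp := (smooth_supp U K).

Let clK : closed K. Proof. by apply: compact_closed => //; exact: norm_hausdorff. Qed.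

Definition e_x (i : 'I_n) : V := (delta_mx 0 i, 0).
Definition e_t : V := (0, 1).

Variables (f F p u : V -> R).
Hypotheses (sf : smoothOn U f) (sF : smoothOn U F) (sp : smoothOn U p).
Hypothesis su : smooth_supp u.

(** With [sym_coef], the coefficients [G] and [H] of the overview: for [F = 0] the first belongs to
    the antisymmetric part of the conjugated operator, the second to the symmetric part. *)
Definition antisym_coef (z : V) : R := F z - \sum_(i < n) 'D_(e_x i) ('D_(e_x i) f) z.
Definition sym_coef (z : V) : R :=
  \sum_(i < n) 'D_(e_x i) f z * 'D_(e_x i) f z - 'D_e_t f z - F z.

Let sG : smoothOn U antisym_coef. Proof. by rewrite /antisym_coef; smooth_rules oU. Qed.
Let sH : smoothOn U sym_coef. Proof. by rewrite /sym_coef; smooth_rules oU. Qed.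

Let v z := expR (f z) * u z.

Let su' : smoothOn U u. Proof. exact: su.1. Qed.
Let sv : smooth_supp v. Proof. by rewrite /v; smooth_rules oU. Qed.
Let sv' : smoothOn U v. Proof. exact: sv.1. Qed.

Let ft := flux_t v sym_coef (fun i => 'D_(e_x i) v).
Let fx := flux_x v ('D_e_t v) antisym_coef sym_coef
  (fun i => 'D_(e_x i) v) (fun i => 'D_(e_x i) f) (fun i => 'D_(e_x i) antisym_coef).

Let sft : smooth_supp ft. Proof. by rewrite /ft /flux_t; smooth_rules oU. Qed.
Let sfx i : smooth_supp (fx i).
Proof. by rewrite /fx /flux_x; smooth_rules oU. Qed.

Let vD w z : U z -> 'D_w v z = expR (f z) * ('D_w f z * u z + 'D_w u z).
Proof.
move=> Uz; have fD := smoothOn_is_derive w sf Uz.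
have uD := smoothOn_is_derive w su' Uz.
have H := is_deriveMl (is_derive_compl fD (is_derive_expR (f z))) uD.
by apply: etrans (@derive_val _ _ _ _ _ _ _ H) _; ring.
Qed.

Let vDD w z : U z -> 'D_w ('D_w v) z =
  expR (f z) * (('D_w ('D_w f) z + 'D_w f z ^+ 2) * u z +
    2 * ('D_w f z * 'D_w u z) + 'D_w ('D_w u) z).
Proof.
move=> Uz; have fD := smoothOn_is_derive w sf Uz.
have uD := smoothOn_is_derive w su' Uz.
have fDD := smoothOn_is_derive w (smoothOn_derive w sf) Uz.
have uDD := smoothOn_is_derive w (smoothOn_derive w su') Uz.
have H := is_deriveMl (is_derive_compl fD (is_derive_expR (f z)))
  (is_deriveDl (is_deriveMl fDD uD) uDD).
apply: etrans (@near_eq_derive _ _ _ _ _ _ w _) _.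
  by apply: eqOn_near oU _ _ _ (fun y => vD w (z := y)) Uz.
apply: etrans (@derive_val _ _ _ _ _ _ _ H) _; cbv beta.
move: (derive (derive f^~ w) z w) (derive (derive u^~ w) z w) (derive f z w)
  (derive u z w) (expR (f z)) (u z) => a b c d e g.
by ring.
Qed.

Let lhs z := expR (2 * f z) * (p z * u z ^+ 2 + \sum_(i < n) 'D_(e_x i) u z ^+ 2).
Let rhs z :=
  expR (2 * f z) * `|'D_e_t u z + \sum_(i < n) 'D_(e_x i) ('D_(e_x i) u) z| ^+ 2.

Let hess z (xi : 'I_n -> R) :=
  \sum_(i < n) \sum_(j < n) 'D_(e_x i) ('D_(e_x j) f) z * xi i * xi j.
Let zeroth z := \sum_(i < n) 'D_(e_x i) ('D_(e_x i) antisym_coef) z - 'D_e_t sym_coef z +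
  2 * (\sum_(i < n) 'D_(e_x i) sym_coef z * 'D_(e_x i) f z) + 2 * sym_coef z * F z.
Let lapf z := \sum_(i < n) 'D_(e_x i) ('D_(e_x i) f) z.
Let ff z := \sum_(i < n) 'D_(e_x i) f z * 'D_(e_x i) f z.

Hypothesis hess_ge0 : forall z, K z -> forall xi : 'I_n -> R,
  0 <= 4 * hess z xi - 2 * F z * (\sum_(i < n) xi i * xi i).

(* The constant [4^-1] completes the square of [(dt + Lap) u] plus half of [u]. *)
Hypothesis zeroth_ge0 : forall z, K z ->
  2 * ff z + lapf z - 'D_e_t f z + p z + 4^-1 <= 3 * zeroth z.

Let divg z := 'D_e_t ft z + \sum_(i < n) 'D_(e_x i) (fx i) z.

Let lapv z := \sum_(i < n) 'D_(e_x i) ('D_(e_x i) v) z.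
Let lapu z := \sum_(i < n) 'D_(e_x i) ('D_(e_x i) u) z.
Let vv z := \sum_(i < n) 'D_(e_x i) v z * 'D_(e_x i) v z.
Let fv z := \sum_(i < n) 'D_(e_x i) f z * 'D_(e_x i) v z.
Let fu z := \sum_(i < n) 'D_(e_x i) f z * 'D_(e_x i) u z.
Let uu z := \sum_(i < n) 'D_(e_x i) u z ^+ 2.

Let vvE z : U z ->
  vv z = expR (f z) ^+ 2 * (ff z * u z ^+ 2 + 2 * u z * fu z + uu z).
Proof.
move=> Uz; rewrite /ff /fu /uu mulr_suml mulr_sumr -!big_split mulr_sumr /=.
apply: eq_bigr => i _; rewrite vD//.
by move: (expR _) ('D_(e_x i) f z) ('D_(e_x i) u z) (u z) => a b c d; ring.
Qed.

Let fvE z : U z -> fv z = expR (f z) * (ff z * u z + fu z).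
Proof.
move=> Uz; rewrite /ff /fu mulr_suml -big_split mulr_sumr /=.
apply: eq_bigr => i _; rewrite vD//.
by move: (expR _) ('D_(e_x i) f z) ('D_(e_x i) u z) (u z) => a b c d; ring.
Qed.

Let lapvE z : U z ->
  lapv z = expR (f z) * (lapf z * u z + ff z * u z + 2 * fu z + lapu z).
Proof.
move=> Uz; rewrite /ff /fu /lapf /lapu !mulr_suml mulr_sumr -!big_split mulr_sumr /=.
apply: eq_bigr => i _; rewrite vDD//.
move: ('D_(e_x i) ('D_(e_x i) f) z) ('D_(e_x i) ('D_(e_x i) u) z) => e g.
by move: (expR _) ('D_(e_x i) f z) ('D_(e_x i) u z) (u z) => a b c d; ring.
Qed.

(** The squares, the Hessian form and the zeroth-order term are nonnegative and discarded; only the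
    divergence, of no definite sign, is kept. *)
Let pointwise_v z : K z ->
  divg z + (vv z - 2 * (v z * fv z) + (ff z + p z) * v z ^+ 2) <=
  4 * (lapv z + 'D_e_t v z - 2 * fv z + (ff z - 'D_e_t f z - lapf z) * v z) ^+ 2.
Proof.
move=> Kz; have Uz := KU Kz.
have sD g w : smoothOn U g -> is_derive z w g ('D_w g z).
  by move=> sg; exact: smoothOn_is_derive.
have sDD g w w' : smoothOn U g -> is_derive z w ('D_w' g) ('D_w ('D_w' g) z).
  by move=> sg; apply: sD; exact: smoothOn_derive.
(* The identity requires one common value for [v_xt] and [v_tx]. *)
have comm i : is_derive z e_t ('D_(e_x i) v) ('D_(e_x i) ('D_e_t v) z).
  by rewrite (derive_comm oU)//; exact: sDD.
have GE : F z = antisym_coef z + lapf z by rewrite /antisym_coef subrK.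
have zo := zeroth_ge0 Kz.
have he : 0 <= 4 * hess z (fun i => 'D_(e_x i) v z) - 2 * F z * vv z.
  exact: hess_ge0 Kz _.
have : 4 * (lapv z + 'D_e_t v z - 2 * fv z + (ff z - 'D_e_t f z - lapf z) * v z) ^+ 2 -
    (vv z - 2 * (v z * fv z) + (ff z + p z) * v z ^+ 2) =
  3 * (lapv z + sym_coef z * v z) ^+ 2 +
  3 * ('D_e_t v z - 2 * fv z + antisym_coef z * v z) ^+ 2 +
  (lapv z + 'D_e_t v z - 2 * fv z + (ff z - 'D_e_t f z - lapf z) * v z + v z / 2) ^+ 2 +
  divg z + 3 * (4 * hess z (fun i => 'D_(e_x i) v z) - 2 * F z * vv z) +
  (3 * zeroth z - (2 * ff z + lapf z - 'D_e_t f z + p z + 4^-1)) * v z ^+ 2.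
  exact: (@carleman_identity R V n e_x e_t z v ('D_e_t v) antisym_coef sym_coef ('D_e_t f) F
    (fun i => 'D_(e_x i) v) (fun i => 'D_(e_x i) f) (fun i => 'D_(e_x i) antisym_coef)
    (fun i j => 'D_(e_x i) ('D_(e_x j) v) z) (fun i j => 'D_(e_x i) ('D_(e_x j) f) z)
    (fun i => 'D_(e_x i) ('D_e_t v) z) (fun i => 'D_(e_x i) sym_coef z)
    (fun i => 'D_(e_x i) ('D_(e_x i) antisym_coef) z) ('D_e_t sym_coef z)
    (fun i => sD _ _ sv') (sD _ _ sv') (fun i => sDD _ _ _ sv') comm
    (fun i j => sDD _ _ _ sv') (fun i j => sDD _ _ _ sf) (fun i => sD _ _ sG)
    (fun i => sDD _ _ _ sG) (fun i => sD _ _ sH) (sD _ _ sH)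
    (fun i j => derive_comm oU _ _ sv' Uz) (p z) GE (erefl _)).
have h4 : 0 <= (3 * zeroth z - (2 * ff z + lapf z - 'D_e_t f z + p z + 4^-1)) * v z ^+ 2.
  by rewrite mulr_ge0 ?sqr_ge0// subr_ge0.
move: he h4; move: (hess z _) (zeroth z) (sym_coef z) (antisym_coef z) => hs ze h g.
move: (lapv z) (lapf z) (vv z) (ff z) (fv z) (divg z) ('D_e_t v z) ('D_e_t f z)
  (v z) (p z) => a1 a2 a3 a4 a5 a6 a7 a8 a9 a10 he h4 E.
have h1 := sqr_ge0 (a1 + h * a9); have h2 := sqr_ge0 (a7 - 2 * a5 + g * a9).
have h3 := sqr_ge0 (a1 + a7 - 2 * a5 + (a4 - a8 - a2) * a9 + a9 / 2).
rewrite -lerBrDr E.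
move: h1 h2 h3 h4 he; set b1 := _ ^+ 2; set b2 := _ ^+ 2; set b3 := _ ^+ 2.
set b4 := _ * _ ^+ 2; set b5 := _ - _; lra.
Qed.

(** Back to [u], through [expR (2 * f z) = expR (f z) ^+ 2]. Off [K] the left side is zero and the
    right side nonnegative. *)
Let pointwise z : divg z + lhs z <= 4 * rhs z.
Proof.
rewrite /rhs real_normK ?num_real// -/(lapu z) /lhs -/(uu z).
have [Kz|Kz] := pselect (K z); last first.
  rewrite /uu /divg su.2// (smooth_supp_derive clK e_t sft).2// big1 => [|i _]; last first.
    by rewrite (smooth_supp_derive clK (e_x i) (sfx i)).2.
  rewrite big1 => [|i _]; last first.
    by rewrite (smooth_supp_derive clK (e_x i) su).2// expr0n.
  rewrite expr0n /= !(mulr0, addr0) mulr_ge0//.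
  by rewrite mulr_ge0 ?expR_ge0// sqr_ge0.
have Uz := KU Kz.
have := pointwise_v Kz; rewrite vvE// lapvE// vD// fvE//.
have -> : expR (2 * f z) = expR (f z) ^+ 2 by rewrite -expRM_natl.
rewrite /v; move: (expR _) (ff z) (u z) (fu z) (uu z) (lapf z) (lapu z) (divg z)
  ('D_e_t f z) ('D_e_t u z) (p z) => a1 a2 a3 a4 a5 a6 a7 a8 a9 a10 a11.
set X := (X in X <= _ -> _); set Y := (Y in X <= Y -> _) => XY.
rewrite [leLHS](_ : _ = X); last by rewrite /X; ring.
by rewrite [leRHS](_ : _ = Y)//; rewrite /Y; ring.
Qed.

Local Open Scope ereal_scope.

Lemma weighted_estimate :
  \int[lebesgue_st]_z (lhs (@to_row R n z))%:E <=
  4%:E * \int[lebesgue_st]_z (rhs (@to_row R n z))%:E.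
Proof.
have slhs : smooth_supp lhs.
  split; first by rewrite /lhs; smooth_rules oU.
  move=> z Kz; rewrite /lhs su.2// expr0n mulr0 add0r big1 ?mulr0// => i _.
  by rewrite (smooth_supp_derive clK (e_x i) su).2// expr0n.
have srhs : smooth_supp rhs.
  split.
    (* Squaring makes the absolute value, which is not smooth, disappear. *)
    rewrite (_ : rhs = fun z => expR (2 * f z) *
        ('D_e_t u z + \sum_(i < n) 'D_(e_x i) ('D_(e_x i) u) z) ^+ 2)%R; last first.
      by apply/funext => z; rewrite /rhs real_normK ?num_real.
    smooth_rules oU.
  move=> z Kz; rewrite /rhs (smooth_supp_derive clK e_t su).2// add0r.
  rewrite big1 ?normr0 ?expr0n ?mulr0// => i _.
  by rewrite (smooth_supp_derive clK (e_x i) (smooth_supp_derive clK (e_x i) su)).2.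
have int g : smooth_supp g ->
    lebesgue_st.-integrable setT (fun z => (g (@to_row R n z))%:E).
  by move=> sg; apply: (integrable_supp cK) sg.2; exact: smooth_supp_cont sg.
have intft := int _ (smooth_supp_derive clK e_t sft).
have intfx i := int _ (smooth_supp_derive clK (e_x i) (sfx i)).
have int_div : \int[lebesgue_st]_z (divg (@to_row R n z))%:E = 0.
  under eq_integral do rewrite /divg EFinD -sumEFin.
  rewrite integralD//; last first.
    by apply: integrable_sum => // i _; exact: intfx.
  rewrite (integral_derive_t cK KU sft) add0r integral_sum//.
  by rewrite big1// => i _; exact: (integral_derive_x cK KU i (sfx i)).
have int_divg : lebesgue_st.-integrable setT (fun z => (divg (@to_row R n z))%:E).
  under eq_fun do rewrite /divg EFinD -sumEFin.
  apply: integrableD => //; apply: integrable_sum => // i _; exact: intfx.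
rewrite -[leLHS]add0e -[X in X + _]int_div -integralD//; last exact: int.
rewrite -integralZl//; last exact: int.
apply: le_integral => //.
- by apply: integrableD => //; exact: int.
- by apply: integrableZl => //; exact: int.
- by move=> z _; rewrite -EFinD -EFinM lee_fin; exact: pointwise.
Qed.

End weighted_estimate.

(** * Building blocks of the weight *)

Section weight.
Context (R : realType) (n : nat).
Local Notation V := ('rV[R]_n.+1 * R)%type.
Implicit Types (z w : V).

Definition xc (i : 'I_n.+1) z : R := z.1 0 i.
Definition tc z : R := z.2.
(** One open set for all three powers below: [x_1 > 0] also forces [rho > 0]. *)
Definition half_space : set V := [set z | 0 < xc 0 z /\ 0 < tc z].
Local Notation U := half_space.

Let xc_is_linear i : linear (xc i).
Proof. by move=> k x y; rewrite /xc /= !mxE. Qed.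
HB.instance Definition _ i := GRing.isLinear.Build R V R _ (xc i) (xc_is_linear i).

Let tc_is_linear : linear tc.
Proof. by []. Qed.
HB.instance Definition _ := GRing.isLinear.Build R V R _ tc tc_is_linear.

Lemma continuous_xc i : continuous (xc i).
Proof.
move=> z; apply: (@continuous_comp _ _ _ fst (fun x : 'rV[R]_n.+1 => x 0 i)).
  exact: cvg_fst.
exact: coord_continuous.
Qed.

Lemma continuous_tc : continuous tc.
Proof. by move=> z; exact: cvg_snd. Qed.

Lemma open_half_space : open U.
Proof.
rewrite (_ : U = xc 0 @^-1` [set r | 0 < r] `&` tc @^-1` [set r | 0 < r]) //.
apply: openI; apply: open_comp; do ?exact: open_gt.
- by move=> z _; exact: continuous_xc.
- by move=> z _; exact: continuous_tc.
Qed.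

Let oU := open_half_space.

Lemma is_derive_xc j i z : is_derive z (@e_x R n.+1 i) (xc j) (i == j)%:R.
Proof.
have H := is_derive_linear (f := xc j) z (@e_x R n.+1 i) (@continuous_xc j).
apply: is_derive_eq H _; rewrite [LHS](_ : _ = (delta_mx 0 i : 'rV[R]_n.+1) 0 j)//.
by rewrite mxE eqxx eq_sym.
Qed.

Lemma is_derive_xc_t j z : is_derive z (@e_t R n.+1) (xc j) 0.
Proof.
have H := is_derive_linear (f := xc j) z (@e_t R n.+1) (@continuous_xc j).
apply: is_derive_eq H _; rewrite [LHS](_ : _ = (0 : 'rV[R]_n.+1) 0 j)//.
by rewrite mxE.
Qed.

Lemma is_derive_tc i z : is_derive z (@e_x R n.+1 i) tc 0.
Proof. by apply: (is_derive_linear (f := tc)); exact: continuous_tc. Qed.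

Lemma is_derive_tc_t z : is_derive z (@e_t R n.+1) tc 1.
Proof. by apply: (is_derive_linear (f := tc)); exact: continuous_tc. Qed.

Definition rho z : R := \sum_(i < n.+1) xc i z * xc i z.

Lemma is_derive_rho i z : is_derive z (@e_x R n.+1 i) rho (2 * xc i z).
Proof.
have dx := is_derive_xc.
rewrite /rho; eapply is_derive_eq; first is_derive_rules.
rewrite (bigD1 i)//= eqxx /= big1 ?addr0 => [|j /negbTE]; first by ring.
by rewrite eq_sym => -> /=; ring.
Qed.

Lemma is_derive_rho_t z : is_derive z (@e_t R n.+1) rho 0.
Proof.
have dx := is_derive_xc_t.
rewrite /rho; eapply is_derive_eq; first is_derive_rules.
by rewrite big1// => j _; ring.
Qed.

Lemma rho_ge z : xc 0 z ^+ 2 <= rho z.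
Proof.
rewrite /rho big_ord_recl /= expr2 lerDl sumr_ge0// => i _.
by rewrite -expr2 sqr_ge0.
Qed.

Lemma rho_gt0 z : U z -> 0 < rho z.
Proof. by move=> [x0 _]; apply: lt_le_trans (rho_ge z); rewrite exprn_gt0. Qed.

Variables (al E a : R).

(* The weights are rational in [xc i], [tc], [rho] and these three powers, a class
   stable under differentiation. *)
Definition yy z := xc 0 z `^ (al - 2).
Definition gg z := rho z `^ ((al - 2) / 2).
Definition tau z := tc z `^ (- (al / 2)).

Lemma is_derive_powRl (h : V -> R) (q : R) z w dh : 0 < h z ->
  is_derive z w h dh -> is_derive z w (fun y => h y `^ q) (q * (h z `^ q / h z) * dh).
Proof.
move=> h0 hh; have H := is_derive1_powR q h0.
apply: is_derive_eq; first exact: (is_derive_compl hh H).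
rewrite powRD; last by rewrite (gt_eqF h0) implybT.
by rewrite powR_inv1// ltW.
Qed.

Lemma is_derive_yy i z : U z ->
  is_derive z (@e_x R n.+1 i) yy ((al - 2) * (yy z / xc 0 z) * (i == 0)%:R).
Proof. by move=> [x0 _]; apply: is_derive_powRl x0 _; exact: is_derive_xc. Qed.

Lemma is_derive_yy_t z : U z -> is_derive z (@e_t R n.+1) yy 0.
Proof.
move=> [x0 _]; apply: is_derive_eq.
  by apply: is_derive_powRl x0 _; exact: is_derive_xc_t.
by rewrite mulr0.
Qed.

Lemma is_derive_gg i z : U z ->
  is_derive z (@e_x R n.+1 i) gg ((al - 2) * (gg z / rho z) * xc i z).
Proof.
move=> Uz; apply: is_derive_eq.
  by apply: is_derive_powRl (rho_gt0 Uz) _; exact: is_derive_rho.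
by rewrite -/(gg z); field; rewrite gt_eqF ?rho_gt0.
Qed.

Lemma is_derive_gg_t z : U z -> is_derive z (@e_t R n.+1) gg 0.
Proof.
move=> Uz; apply: is_derive_eq.
  by apply: is_derive_powRl (rho_gt0 Uz) _; exact: is_derive_rho_t.
by rewrite mulr0.
Qed.

Lemma is_derive_tau i z : U z -> is_derive z (@e_x R n.+1 i) tau 0.
Proof.
move=> [_ t0]; apply: is_derive_eq.
  by apply: is_derive_powRl t0 _; exact: is_derive_tc.
by rewrite mulr0.
Qed.

Lemma is_derive_tau_t z : U z ->
  is_derive z (@e_t R n.+1) tau (- (al / 2) * (tau z / tc z)).
Proof.
move=> [_ t0]; apply: is_derive_eq.
  by apply: is_derive_powRl t0 _; exact: is_derive_tc_t.
by rewrite mulr1.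
Qed.

Lemma smooth_xc i : smoothOn U (xc i).
Proof. by apply: smoothOn_linear => //; exact: continuous_xc. Qed.

Lemma smooth_tc : smoothOn U tc.
Proof. by apply: (smoothOn_linear oU (f := tc)); exact: continuous_tc. Qed.

Lemma smooth_rho : smoothOn U rho.
Proof. by have sx := smooth_xc; rewrite /rho; smooth_rules oU. Qed.

Lemma smooth_yy : smoothOn U yy.
Proof. by apply: smoothOn_powR => //; [move=> z []|exact: smooth_xc]. Qed.

Lemma smooth_gg : smoothOn U gg.
Proof. by apply: smoothOn_powR => //; [exact: rho_gt0|exact: smooth_rho]. Qed.

Lemma smooth_tau : smoothOn U tau.
Proof. by apply: smoothOn_powR => //; [move=> z []|exact: smooth_tc]. Qed.

End weight.

(** * Closed forms for the derivatives of the weight *)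

Section weight_derivatives.
Context (R : realType) (n : nat).
Local Notation V := ('rV[R]_n.+1 * R)%type.
Implicit Types (z w : V).
Local Notation U := (@half_space R n).
Local Notation x0 := (xc (0 : 'I_n.+1)).
Local Notation e_x := (@e_x R n.+1).
Local Notation e_t := (@e_t R n.+1).
Local Notation "'d_ i" := ((i == 0)%:R : R) (at level 2, i at level 1, format "''d_' i").
Variables (al E a : R).
Local Notation yy := (@yy R n al).
Local Notation gg := (@gg R n al).
Local Notation tau := (@tau R n al).
Local Notation N := (n.+1%:R : R).
Local Notation be := (al / 2).

Let oU := @open_half_space R n.

Definition Lm z := (1 - tc z) * tau z.
(** The time derivative of [Lm], arranged so that for [al > 0] the factor [be / t + 1 - be] is
    visibly at least 1 on [(0, 1)]. *)
Definition dLm z := - (tau z * (be * (tc z)^-1 + 1 - be)).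
(** This is [varphi] for [E = eps^alpha], its powers factored through the exponent [alpha - 2] of
    the Hessian. *)
Definition phi0 z := x0 z * x0 z * yy z - E * (rho z * gg z).
Definition weight z := a * (Lm z * phi0 z) + tc z * tc z.
Definition multiplier z := - 2 * a * al * E * (Lm z * gg z).

Definition weight_x (i : 'I_n.+1) z :=
  a * al * (Lm z * (yy z * x0 z * 'd_i - E * (gg z * xc i z))).
Definition weight_t z := a * (dLm z * phi0 z) + 2 * tc z.

Let smooth_base : [/\ forall i, smoothOn U (xc i), smoothOn U (@tc R n),
  smoothOn U (@rho R n), smoothOn U yy & (smoothOn U gg * smoothOn U tau)%type].
Proof.
split; [exact: smooth_xc|exact: smooth_tc|exact: smooth_rho|exact: smooth_yy|].
by split; [exact: smooth_gg|exact: smooth_tau].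
Qed.

Lemma smooth_weight : smoothOn U weight.
Proof.
by have [? ? ? ? [? ?]] := smooth_base; rewrite /weight /phi0 /Lm; smooth_rules oU.
Qed.

Lemma smooth_multiplier : smoothOn U multiplier.
Proof.
by have [? ? ? ? [? ?]] := smooth_base; rewrite /multiplier /Lm; smooth_rules oU.
Qed.

(** A closed form valid on the open set [U] holds near each of its points, so it may be
    differentiated again. *)
Lemma derive_eqOn (h k : V -> R) z w d : (forall y, U y -> h y = k y) -> U z ->
  is_derive z w k d -> 'D_w h z = d.
Proof.
move=> hk Uz kd; apply: etrans (@derive_val _ _ _ _ _ _ _ kd).
by apply: near_eq_derive; exact: (eqOn_near oU).
Qed.

Section at_point.
Variables (z : V) (Uz : U z).

Let X0 : x0 z != 0. Proof. by case: Uz => h _; rewrite gt_eqF. Qed.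
Let T0 : tc z != 0. Proof. by case: Uz => _ h; rewrite gt_eqF. Qed.
Let R0 : rho z != 0. Proof. by rewrite gt_eqF ?rho_gt0. Qed.

Let dx j i : is_derive z (e_x i) (xc j) (i == j)%:R := is_derive_xc j i z.
Let dx_t j : is_derive z e_t (xc j) 0 := is_derive_xc_t j z.
Let dt i : is_derive z (e_x i) (@tc R n) 0 := is_derive_tc i z.
Let dt_t : is_derive z e_t (@tc R n) 1 := is_derive_tc_t z.
Let dr i : is_derive z (e_x i) (@rho R n) (2 * xc i z) := is_derive_rho i z.
Let dr_t : is_derive z e_t (@rho R n) 0 := is_derive_rho_t z.
Let dy i : is_derive z (e_x i) yy _ := is_derive_yy al i Uz.
Let dy_t : is_derive z e_t yy 0 := is_derive_yy_t al Uz.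
Let dg i : is_derive z (e_x i) gg _ := is_derive_gg al i Uz.
Let dg_t : is_derive z e_t gg 0 := is_derive_gg_t al Uz.
Let dtau i : is_derive z (e_x i) tau 0 := is_derive_tau al i Uz.
Let dtau_t : is_derive z e_t tau _ := is_derive_tau_t al Uz.

Let d_inv (h : V -> R) (w : V) dh : h z != 0 -> is_derive z w h dh ->
  is_derive z w (fun y => (h y)^-1) (- ((h z)^-1 * (h z)^-1) * dh).
Proof.
move=> h0 hh; apply: (@is_derive_compl _ _ GRing.inv _ _ _ _ _ hh).
apply: is_derive_eq; first by apply: (@is_deriveV R id); exact: h0.
by rewrite /GRing.scale /= mulr1 expr2 invfM.
Qed.

Let dix i : is_derive z (e_x i) (fun y => (x0 y)^-1) _ := d_inv X0 (dx 0 i).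
Let dir i : is_derive z (e_x i) (fun y => (rho y)^-1) _ := d_inv R0 (dr i).
Let ditx i : is_derive z (e_x i) (fun y => (tc y)^-1) _ := d_inv T0 (dt i).
Let dit : is_derive z e_t (fun y => (tc y)^-1) _ := d_inv T0 dt_t.

Lemma is_derive_weight i : is_derive z (e_x i) weight (weight_x i z).
Proof.
rewrite /weight /phi0 /Lm; eapply is_derive_eq; first is_derive_rules.
rewrite /weight_x /Lm; move: X0 R0.
move: (x0 z) (xc i z) (yy z) (gg z) (rho z) (tau z) (tc z) 'd_i => A B C D F G H J h1 h2.
by field; rewrite h1 h2.
Qed.

Lemma is_derive_weight_t : is_derive z e_t weight (weight_t z).
Proof.
rewrite /weight /phi0 /Lm; eapply is_derive_eq; first is_derive_rules.
rewrite /weight_t /dLm /phi0; move: T0.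
move: (x0 z) (yy z) (gg z) (rho z) (tau z) (tc z) => A B C D F G h1.
by field; rewrite h1.
Qed.

Definition weight_xx (i j : 'I_n.+1) y := a * al * (Lm y *
  ((al - 1) * yy y * 'd_i * 'd_j -
   E * (gg y * (i == j)%:R + (al - 2) * (gg y / rho y) * xc i y * xc j y))).

Lemma is_derive_weight_x i j : is_derive z (e_x i) (weight_x j) (weight_xx i j z).
Proof.
rewrite /weight_x /Lm; eapply is_derive_eq; first is_derive_rules.
rewrite /weight_xx /Lm; move: X0 R0.
move: (x0 z) (xc i z) (xc j z) (yy z) (gg z) (rho z) (tau z) (tc z) 'd_i 'd_j
  ((i == j)%:R : R) => A A' B C D F G H J J' K h1 h2.
by field; rewrite h1 h2.
Qed.

Definition antisym_weight y :=
  a * al * (Lm y * (E * (al + N - 4) * gg y - (al - 1) * yy y)).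

Definition antisym_x (i : 'I_n.+1) y := a * al * (Lm y *
  (E * (al + N - 4) * (al - 2) * (gg y * (rho y)^-1 * xc i y) -
   (al - 1) * (al - 2) * (yy y * (x0 y)^-1 * 'd_i))).

Lemma is_derive_antisym_weight i : is_derive z (e_x i) antisym_weight (antisym_x i z).
Proof.
rewrite /antisym_weight /Lm; eapply is_derive_eq; first is_derive_rules.
rewrite /antisym_x /Lm; move: X0 R0.
move: (x0 z) (xc i z) (yy z) (gg z) (rho z) (tau z) (tc z) 'd_i => A B C D F G H J h1 h2.
by field; rewrite h1 h2.
Qed.

Definition antisym_xx (i : 'I_n.+1) y := a * al * (Lm y *
  (E * (al + N - 4) * (al - 2) *
     (gg y / rho y + (al - 4) * (gg y / rho y ^+ 2) * (xc i y * xc i y)) -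
   (al - 1) * (al - 2) * (al - 3) * (yy y / x0 y ^+ 2) * ('d_i * 'd_i))).

Lemma is_derive_antisym_x i : is_derive z (e_x i) (antisym_x i) (antisym_xx i z).
Proof.
rewrite /antisym_x /Lm; eapply is_derive_eq; first is_derive_rules.
have -> : (i == i)%:R = 1 :> R by rewrite eqxx.
rewrite /antisym_xx /Lm; move: X0 R0.
move: (x0 z) (xc i z) (yy z) (gg z) (rho z) (tau z) (tc z) 'd_i => A B C D F G H J h1 h2.
by field; rewrite h1 h2.
Qed.

(** This is [|grad varphi|^2], from [grad varphi = al (x_1 yy e_1 - E gg x)]. *)
Definition grad2 y := al ^+ 2 * (x0 y * x0 y * (yy y * yy y) -
  2 * E * (x0 y * x0 y * (yy y * gg y)) + E * E * (rho y * (gg y * gg y))).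

Definition sym_weight y := a * a * (Lm y * Lm y * grad2 y) - a * (dLm y * phi0 y) -
  2 * tc y + 2 * a * al * E * (Lm y * gg y).

Definition d2Lm y := tau y * (be * (be + 1) / tc y ^+ 2 + be * (1 - be) / tc y).

Definition sym_t y := 2 * a ^+ 2 * (Lm y * dLm y * grad2 y) - a * (d2Lm y * phi0 y) - 2 +
  2 * a * al * E * (dLm y * gg y).

(** The gradient of [sym_weight] lies in the span of [e_1] and [x]; [sym_x1] and [sym_x2] are its
    coordinates. *)
Definition sym_x1 y := a ^+ 2 * Lm y ^+ 2 * al ^+ 2 *
    (2 * (al - 1) * x0 y * yy y ^+ 2 - 2 * E * al * x0 y * yy y * gg y) -
  a * dLm y * (al * yy y * x0 y).

Definition sym_x2 y := a ^+ 2 * Lm y ^+ 2 * al ^+ 2 *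
    (2 * E ^+ 2 * (al - 1) * gg y ^+ 2 -
     2 * E * (al - 2) * x0 y ^+ 2 * yy y * gg y / rho y) +
  a * dLm y * (al * E * gg y) + 2 * a * al * E * Lm y * (al - 2) * gg y / rho y.

Lemma is_derive_sym_weight i :
  is_derive z (e_x i) sym_weight (sym_x1 z * 'd_i + sym_x2 z * xc i z).
Proof.
rewrite /sym_weight /grad2 /dLm /phi0 /Lm; eapply is_derive_eq; first is_derive_rules.
rewrite /sym_x1 /sym_x2 /dLm /Lm; move: X0 R0 T0.
move: (x0 z) (xc i z) (yy z) (gg z) (rho z) (tau z) (tc z) 'd_i => A B C D F G H J h1 h2 h3.
by field; rewrite h1 h2 h3.
Qed.

Lemma is_derive_sym_weight_t : is_derive z e_t sym_weight (sym_t z).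
Proof.
rewrite /sym_weight /grad2 /dLm /phi0 /Lm; eapply is_derive_eq; first is_derive_rules.
rewrite /sym_t /grad2 /d2Lm /dLm /phi0 /Lm; move: T0.
move: (x0 z) (yy z) (gg z) (rho z) (tau z) (tc z) => A B C D F G h1.
by field; rewrite h1.
Qed.

End at_point.

(** Inner product in the frame [e_1], [x], to which the gradients of the weight and of [sym_weight]
    belong; it leaves only [x_1] and [rho]. *)
Lemma sum_radial z (p q p' q' : R) :
  \sum_(i < n.+1) (p * 'd_i + q * xc i z) * (p' * 'd_i + q' * xc i z) =
  p * p' + (p * q' + q * p') * x0 z + q * q' * rho z.
Proof.
rewrite /rho !big_ord_recl /= (eq_bigr (fun i =>
  q * q' * (xc (lift ord0 i) z * xc (lift ord0 i) z))).
  by rewrite -mulr_sumr; set s := \sum_(_ < _) _; ring.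
by move=> i _; ring.
Qed.

Lemma sum_delta : \sum_(i < n.+1) 'd_i * 'd_i = 1.
Proof. by rewrite big_ord_recl /= big1 ?mulr1 ?addr0// => i _; rewrite mulr0. Qed.

Lemma derive_weight i z : U z -> 'D_(e_x i) weight z = weight_x i z.
Proof. by move=> Uz; exact: @derive_val _ _ _ _ _ _ _ (is_derive_weight Uz i). Qed.

Lemma derive_weight_t z : U z -> 'D_e_t weight z = weight_t z.
Proof. by move=> Uz; exact: @derive_val _ _ _ _ _ _ _ (is_derive_weight_t Uz). Qed.

Lemma derive2_weight i j z : U z -> 'D_(e_x i) ('D_(e_x j) weight) z = weight_xx i j z.
Proof.
move=> Uz; apply: (derive_eqOn (k := weight_x j)) Uz (is_derive_weight_x Uz i j) => y.
exact: derive_weight.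
Qed.

Definition lap_weight z := a * al * (Lm z *
  ((al - 1) * yy z - E * (gg z * (N + al - 2)))).

Lemma laplacian_weight z : U z ->
  \sum_(i < n.+1) 'D_(e_x i) ('D_(e_x i) weight) z = lap_weight z.
Proof.
move=> Uz; under eq_bigr do rewrite derive2_weight//.
have -> : \sum_(i < n.+1) weight_xx i i z = a * al * (Lm z *
    ((al - 1) * yy z * (\sum_(i < n.+1) 'd_i * 'd_i) -
     E * (gg z * N + (al - 2) * (gg z / rho z) * rho z))).
  rewrite (_ : N = \sum_(i < n.+1) 1); last by rewrite sumr_const card_ord.
  rewrite {2}/rho !mulr_sumr -big_split /= mulr_sumr -sumrB !mulr_sumr.
  apply: eq_bigr => i _; rewrite /weight_xx.
  have -> : (i == i)%:R = 1 :> R by rewrite eqxx.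
  by move: (yy z) (gg z) (rho z) (xc i z) (Lm z) => A B C D F; ring.
rewrite sum_delta /lap_weight; have := rho_gt0 Uz.
move: (yy z) (gg z) (rho z) (Lm z) => A B C D C0; field; by rewrite gt_eqF.
Qed.

Lemma grad_weight z : U z ->
  \sum_(i < n.+1) 'D_(e_x i) weight z * 'D_(e_x i) weight z = a ^+ 2 * Lm z ^+ 2 * grad2 z.
Proof.
move=> Uz; under eq_bigr do rewrite derive_weight//.
rewrite (eq_bigr (fun i => (a * al * Lm z) ^+ 2 *
    (((yy z * x0 z) * 'd_i + (- E * gg z) * xc i z) *
     ((yy z * x0 z) * 'd_i + (- E * gg z) * xc i z)))); last first.
  move=> i _; rewrite /weight_x.
  by move: (x0 z) (xc i z) (yy z) (gg z) (Lm z) => A B C D F; ring.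
rewrite -mulr_sumr sum_radial /grad2.
by move: (x0 z) (yy z) (gg z) (Lm z) (rho z) => A C D F G; ring.
Qed.

(** The Hessian is a multiple of the identity plus two rank-one forms, along [e_1] and along [x]. *)
Lemma hess_weight z (xi : 'I_n.+1 -> R) : U z ->
  \sum_(i < n.+1) \sum_(j < n.+1) 'D_(e_x i) ('D_(e_x j) weight) z * xi i * xi j =
  a * al * (Lm z * ((al - 1) * yy z * xi 0 ^+ 2 -
    E * (gg z * (\sum_(i < n.+1) xi i * xi i) +
      (al - 2) * (gg z / rho z) * (\sum_(i < n.+1) xc i z * xi i) ^+ 2))).
Proof.
move=> Uz.
have S0 : \sum_(i < n.+1) 'd_i * xi i = xi 0.
  by rewrite big_ord_recl /= mul1r big1 ?addr0// => i _; rewrite mul0r.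
have S1 i : \sum_(j < n.+1) (i == j)%:R * xi j = xi i.
  rewrite (bigD1 i)//= eqxx mul1r big1 ?addr0// => j /negbTE.
  by rewrite eq_sym => ->; rewrite mul0r.
set s := \sum_(i < n.+1) xc i z * xi i.
pose A := a * al * Lm z * ((al - 1) * yy z); pose B := - (a * al * Lm z * E * gg z).
pose C := - (a * al * Lm z * E * (al - 2) * (gg z / rho z)).
have inner i : \sum_(j < n.+1) 'D_(e_x i) ('D_(e_x j) weight) z * xi i * xi j =
    A * xi 0 * ('d_i * xi i) + B * (xi i * xi i) + C * s * (xc i z * xi i).
  under eq_bigr do rewrite derive2_weight//.
  rewrite (eq_bigr (fun j => A * 'd_i * xi i * ('d_j * xi j) +
    B * xi i * ((i == j)%:R * xi j) + C * xc i z * xi i * (xc j z * xi j))).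
    by rewrite !big_split -!mulr_sumr S0 S1 -/s /=; ring.
  move=> j _; rewrite /weight_xx /A /B /C.
  move: (xi i) (xi j) 'd_i 'd_j (xc i z) (xc j z) ((i == j)%:R : R) => b1 b2 b3 b4 b5 b6 b7.
  by move: (yy z) (gg z) (Lm z) (gg z / rho z) => B1 B2 B3 B4; ring.
under eq_bigr do rewrite inner.
rewrite !big_split -!mulr_sumr S0 -/s /= /A /B /C {inner}.
move: (\sum_(i < n.+1) xi i * xi i) s (xi 0) => b1 b2 b3.
by move: (yy z) (gg z) (Lm z) (gg z / rho z) => B1 B2 B3 B4; ring.
Qed.

Lemma antisym_coefE z : U z -> antisym_coef weight multiplier z = antisym_weight z.
Proof.
move=> Uz; rewrite /antisym_coef laplacian_weight// /multiplier /antisym_weight /lap_weight.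
by move: (yy z) (gg z) (Lm z) => A B D; ring.
Qed.

Lemma sym_coefE z : U z -> sym_coef weight multiplier z = sym_weight z.
Proof.
move=> Uz; rewrite /sym_coef grad_weight// derive_weight_t// /weight_t /multiplier /sym_weight.
by move: (Lm z) (dLm z) (grad2 z) (phi0 z) (gg z) (tc z) => A B C D F G; ring.
Qed.

Definition lap_antisym z := a * al * (Lm z *
  (E * (al + N - 4) * (al - 2) * ((N + al - 4) * (gg z / rho z)) -
   (al - 1) * (al - 2) * (al - 3) * (yy z / x0 z ^+ 2))).

Lemma laplacian_antisym_coef z : U z ->
  \sum_(i < n.+1) 'D_(e_x i) ('D_(e_x i) (antisym_coef weight multiplier)) z =
  lap_antisym z.
Proof.
move=> Uz; have wGx1 i y : U y -> 'D_(e_x i) (antisym_coef weight multiplier) y =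
    antisym_x i y.
  by move=> Uy; apply: derive_eqOn antisym_coefE Uy (is_derive_antisym_weight Uy i).
have D2 i : 'D_(e_x i) ('D_(e_x i) (antisym_coef weight multiplier)) z = antisym_xx i z.
  exact: derive_eqOn (wGx1 i) Uz (is_derive_antisym_x Uz i).
under eq_bigr do rewrite D2.
have -> : \sum_(i < n.+1) antisym_xx i z = a * al * (Lm z *
  (E * (al + N - 4) * (al - 2) *
     (gg z / rho z * N + (al - 4) * (gg z / rho z ^+ 2) * rho z) -
   (al - 1) * (al - 2) * (al - 3) * (yy z / x0 z ^+ 2) *
     (\sum_(i < n.+1) 'd_i * 'd_i))).
  rewrite (_ : gg z / rho z * N = \sum_(i < n.+1) gg z / rho z); last first.
    by rewrite sumr_const card_ord mulr_natr.
  rewrite {3}/rho !mulr_sumr -big_split /= mulr_sumr -sumrB !mulr_sumr.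
  by apply: eq_bigr => i _; rewrite /antisym_xx.
rewrite sum_delta /lap_antisym; have := rho_gt0 Uz; case: (Uz) => A0 _.
move: A0; move: (x0 z) (yy z) (gg z) (rho z) (Lm z) => A' A B C D A0 C0.
by field; rewrite !gt_eqF.
Qed.

Lemma derive_sym_coef_t z : U z -> 'D_e_t (sym_coef weight multiplier) z = sym_t z.
Proof. by move=> Uz; exact: derive_eqOn sym_coefE Uz (is_derive_sym_weight_t Uz). Qed.

Definition sym_dot_weight z := a * al * Lm z *
  (sym_x1 z * (yy z * x0 z) +
   (sym_x1 z * (- E * gg z) + sym_x2 z * (yy z * x0 z)) * x0 z +
   sym_x2 z * (- E * gg z) * rho z).

Lemma sym_coef_dot_weight z : U z ->
  \sum_(i < n.+1) 'D_(e_x i) (sym_coef weight multiplier) z * 'D_(e_x i) weight z =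
  sym_dot_weight z.
Proof.
move=> Uz.
have D1 i : 'D_(e_x i) (sym_coef weight multiplier) z = sym_x1 z * 'd_i + sym_x2 z * xc i z.
  exact: derive_eqOn sym_coefE Uz (is_derive_sym_weight Uz i).
under eq_bigr do rewrite D1 derive_weight//.
rewrite (eq_bigr (fun i => (a * al * Lm z) *
    ((sym_x1 z * 'd_i + sym_x2 z * xc i z) *
     ((yy z * x0 z) * 'd_i + (- E * gg z) * xc i z)))); last first.
  move=> i _; rewrite /weight_x.
  by move: (sym_x1 z) (sym_x2 z) (x0 z) (xc i z) (yy z) (gg z) (Lm z)
    => a1 a2 A B C D F; ring.
by rewrite -mulr_sumr sum_radial.
Qed.

End weight_derivatives.

(** * Positivity of the zeroth-order coefficient, as algebra over an ordered field *)

Section zeroth_order_inequality.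
Variable R : realFieldType.
Variables (a al E N t tau x rho y g eps Y0 : R).
Local Notation be := (al / 2).
Local Notation L := ((1 - t) * tau).
Local Notation dL := (- (tau * (be * t^-1 + 1 - be))).
Local Notation d2L := (tau * (be * (be + 1) / t ^+ 2 + be * (1 - be) / t)).
Local Notation p0 := (x * x * y - E * (rho * g)).
Local Notation P0 := (al ^+ 2 * (x * x * (y * y) - 2 * E * (x * x * (y * g)) +
  E * E * (rho * (g * g)))).
Local Notation sG := (a * al * (L *
  (E * (al + N - 4) * (al - 2) * ((N + al - 4) * (g / rho)) -
   (al - 1) * (al - 2) * (al - 3) * (y / x ^+ 2)))).
Local Notation Ht := (2 * a ^+ 2 * (L * dL * P0) - a * (d2L * p0) - 2 +
  2 * a * al * E * (dL * g)).
Local Notation h1 := (a ^+ 2 * L ^+ 2 * al ^+ 2 *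
    (2 * (al - 1) * x * y ^+ 2 - 2 * E * al * x * y * g) -
  a * dL * (al * y * x)).
Local Notation h2 := (a ^+ 2 * L ^+ 2 * al ^+ 2 *
    (2 * E ^+ 2 * (al - 1) * g ^+ 2 -
     2 * E * (al - 2) * x ^+ 2 * y * g / rho) +
  a * dL * (al * E * g) + 2 * a * al * E * L * (al - 2) * g / rho).
Local Notation Hf := (a * al * L * (h1 * (y * x) +
   (h1 * (- E * g) + h2 * (y * x)) * x + h2 * (- E * g) * rho)).
Local Notation He := (a * a * (L * L * P0) - a * (dL * p0) - 2 * t +
  2 * a * al * E * (L * g)).
Local Notation Fe := (- 2 * a * al * E * (L * g)).
Local Notation kappa :=
  (eps ^+ 2 * (1 - E) ^+ 2 * (al - 1 - 2 * E) - 2 * E ^+ 3 * (1 - eps ^+ 2)).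

(* Up to a factor [al ^+ 3], the Hessian of [varphi] plus half of [F / (a Lambda)]
   evaluated at the gradient of [varphi]. *)
Definition cubic_coef := x ^+ 2 * (y - E * g) ^+ 2 * ((al - 1) * y - 2 * E * g) -
  2 * E ^+ 3 * g ^+ 3 * (rho - x ^+ 2) + (2 - al) * E * g * p0 ^+ 2 / rho.

Hypotheses (t0 : 0 < t) (t1 : t < 1) (x1 : 1 < x) (hrho : x ^+ 2 <= rho)
  (heps : eps ^+ 2 * rho <= x ^+ 2) (eps0 : 0 < eps) (eps1 : eps < 1)
  (g0 : 0 < g) (gy : g <= y) (yg : y <= Y0 * g) (y1 : y <= 1) (xy : 1 <= x * y)
  (p0_ge0 : 0 <= p0) (tau1 : 1 <= tau)
  (al43 : 4 / 3 <= al) (al2 : al < 2) (E0 : 0 < E) (E25 : E <= 2 / 5)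
  (N1 : 1 <= N) (k0 : 0 < kappa).

Local Ltac pull := have := t0; have := t1; have := x1; have := g0; have := gy;
  have := y1; have := tau1; have := al43; have := al2; have := E0; have := E25;
  have := N1; have := xy; move=> ? ? ? ? ? ? ? ? ? ? ? ? ?.

Let rho1 : 1 < rho.
Proof. by apply: lt_le_trans hrho; rewrite expr_gt1// ltW// (lt_trans ltr01). Qed.
Let rho0 : 0 < rho. Proof. exact: lt_trans ltr01 rho1. Qed.
Let x0 : 0 < x. Proof. exact: lt_trans ltr01 x1. Qed.
Let y0 : 0 < y. Proof. exact: lt_le_trans g0 gy. Qed.
Let tau0 : 0 < tau. Proof. exact: lt_le_trans ltr01 tau1. Qed.

(** Grouping by order: the cubic term, [a ^+ 2 * L * (- dL)] and [a * d2L * p0] are favourable, and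
    whatever may be negative carries [a * L]. *)
Let zerothE : sG - Ht + 2 * Hf + 2 * He * Fe =
  sG + a * d2L * p0 + 2 + 2 * a * al * E * (- dL) * g +
  4 * a ^+ 2 * L * (- dL) * (P0 - al * E * g * p0) +
  4 * a ^+ 3 * L ^+ 3 * al ^+ 3 * cubic_coef -
  4 * a ^+ 2 * al ^+ 2 * E * L ^+ 2 * (2 - al) * g * (p0 / rho) -
  8 * a ^+ 2 * al ^+ 2 * E ^+ 2 * L ^+ 2 * g ^+ 2 + 8 * t * a * al * E * L * g.
Proof. by rewrite /cubic_coef; field; rewrite !gt_eqF. Qed.

(** Otherwise both terms of [kappa] would be nonpositive. *)
Let alE : 0 < al - 1 - 2 * E.
Proof. pull.
rewrite ltNge; apply/negP => h; move: k0; apply/negP; rewrite -leNgt.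
have e1 : 0 <= 1 - eps ^+ 2 by rewrite subr_ge0 exprn_ile1// ltW.
have h1' : eps ^+ 2 * (1 - E) ^+ 2 * (al - 1 - 2 * E) <= 0.
  by rewrite mulr_ge0_le0// mulr_ge0// sqr_ge0.
have h2' : 0 <= 2 * E ^+ 3 * (1 - eps ^+ 2).
  by rewrite mulr_ge0// mulr_ge0// exprn_ge0// ltW.
by lra.
Qed.

(** The last summand is dropped, [y] is lowered to [g], then [x ^+ 2] to [eps ^+ 2 * rho]: the worst
    case is the boundary of the cone, and [kappa] is what remains there. *)
Let cubic_coef_ge : kappa * rho * g ^+ 3 <= cubic_coef.
Proof. pull.
have yE : (1 - E) * g <= y - E * g by rewrite mulrBl mul1r lerB.
have gE : 0 <= (1 - E) * g by rewrite mulr_ge0//; lra.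
have s1 : ((1 - E) * g) ^+ 2 <= (y - E * g) ^+ 2.
  by rewrite ler_sqr// nnegrE//; exact: le_trans yE.
have s2 : (al - 1 - 2 * E) * g <= (al - 1) * y - 2 * E * g.
  have : 0 <= (al - 1) * (y - g) by rewrite mulr_ge0//; lra.
  nra.
have s3 : 0 <= (al - 1 - 2 * E) * g by rewrite mulr_ge0// ltW.
have s4 : ((1 - E) * g) ^+ 2 * ((al - 1 - 2 * E) * g) <=
    (y - E * g) ^+ 2 * ((al - 1) * y - 2 * E * g) by rewrite ler_pM// sqr_ge0.
have s5 : x ^+ 2 * (((1 - E) * g) ^+ 2 * ((al - 1 - 2 * E) * g)) <=
    x ^+ 2 * ((y - E * g) ^+ 2 * ((al - 1) * y - 2 * E * g)).
  by rewrite ler_wpM2l// sqr_ge0.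
have s6 : 0 <= (2 - al) * E * g * p0 ^+ 2 / rho.
  apply: divr_ge0; last exact: ltW.
  rewrite mulr_ge0 ?sqr_ge0//; apply: mulr_ge0; last exact: ltW.
  by apply: mulr_ge0; lra.
have s7 : 0 <= (x ^+ 2 - eps ^+ 2 * rho) *
    (g ^+ 3 * ((1 - E) ^+ 2 * (al - 1 - 2 * E) + 2 * E ^+ 3)).
  apply: mulr_ge0; first by rewrite subr_ge0.
  apply: mulr_ge0; first by rewrite exprn_ge0// ltW.
  apply: addr_ge0; first by rewrite mulr_ge0 ?sqr_ge0// ltW.
  by rewrite mulr_ge0// exprn_ge0// ltW.
rewrite /cubic_coef; move: s5 s6 s7; set c := _ / rho; move: c => c; nra.
Qed.

(** Here the numerical bounds meet: [E <= 2 / 5] gives [y - E * g >= 3 / 5 * g], and [al >= 4 / 3]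
    gives [al / 2 * (y - E * g) >= 2 / 5 * g >= E * g]. *)
Let half_P0 : P0 / 2 <= P0 - al * E * g * p0.
Proof. pull.
have s1 : 0 <= x ^+ 2 * (y - E * g) * (al / 2 * (y - E * g) - E * g).
  have yE : 3 / 5 * g <= y - E * g.
    have : E * g <= 2 / 5 * g by rewrite ler_wpM2r// ltW.
    lra.
  rewrite mulr_ge0//; last first.
    have : 2 / 3 * (3 / 5 * g) <= al / 2 * (y - E * g).
      by rewrite ler_pM//; lra.
    have : E * g <= 2 / 5 * g by rewrite ler_wpM2r// ltW.
    lra.
  by rewrite mulr_ge0 ?sqr_ge0//; lra.
have s2 : 0 <= (al / 2 + 1) * E ^+ 2 * g ^+ 2 * (rho - x ^+ 2).
  by rewrite mulr_ge0 ?subr_ge0// mulr_ge0 ?sqr_ge0// mulr_ge0 ?sqr_ge0//; lra.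
have s3 : 0 <= al * (x ^+ 2 * (y - E * g) * (al / 2 * (y - E * g) - E * g) +
   (al / 2 + 1) * E ^+ 2 * g ^+ 2 * (rho - x ^+ 2)).
  by rewrite mulr_ge0 ?addr_ge0//; lra.
rewrite -subr_ge0; apply: le_trans s3 _; rewrite le_eqVlt; apply/orP; left.
by apply/eqP; field.
Qed.

(** In the application [x * y] is [x_1^(alpha-1)], at least 1 because [x_1 > 1]; hence
    [P0 >= (4 / 3 * (3 / 5)) ^+ 2 = 16 / 25]. *)
Let P0_ge : 1 / 2 <= P0.
Proof. pull.
have yE : 3 / 5 * y <= y - E * g.
  have : E * g <= 2 / 5 * y by rewrite ler_pM// ltW.
  lra.
have s1 : 3 / 5 <= x * (y - E * g).
  have : x * (3 / 5 * y) <= x * (y - E * g) by rewrite ler_wpM2l// ltW.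
  lra.
have s2 : (3 / 5) ^+ 2 <= (x * (y - E * g)) ^+ 2.
  by rewrite ler_sqr// nnegrE//; lra.
have s3 : 0 <= E ^+ 2 * g ^+ 2 * (rho - x ^+ 2).
  by rewrite mulr_ge0 ?subr_ge0// mulr_ge0 ?sqr_ge0.
have s4 : (4 / 3) ^+ 2 <= al ^+ 2 by rewrite ler_sqr// nnegrE; lra.
have -> : P0 = al ^+ 2 * ((x * (y - E * g)) ^+ 2 + E ^+ 2 * g ^+ 2 * (rho - x ^+ 2)).
  ring.
have : (4 / 3) ^+ 2 * (3 / 5) ^+ 2 <=
    al ^+ 2 * ((x * (y - E * g)) ^+ 2 + E ^+ 2 * g ^+ 2 * (rho - x ^+ 2)).
  by rewrite ler_pM ?sqr_ge0//; lra.
by apply: le_trans; lra.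
Qed.

Let L0 : 0 < L. Proof. by rewrite mulr_gt0// subr_gt0. Qed.

Let tV : 1 < t^-1. Proof. by rewrite invf_gt1. Qed.

Let dL_ge : tau <= - dL.
Proof. pull; have tV' := tV.
rewrite opprK -[leLHS]mulr1 ler_wpM2l ?ltW//.
have : 0 < be * (t^-1 - 1) by rewrite mulr_gt0//; lra.
lra.
Qed.

Let L_dL : L <= - dL.
Proof. pull. by apply: le_trans dL_ge; rewrite ler_piMl ?ltW//; lra. Qed.

(** Lets [3 * a * d2L * p0] pay both the [a * p0] of the estimate and the [- a * dL * p0] of
    [- phi_t]. In the proof, [10 / 9] is [be * (be + 1)] at [al = 4 / 3]. *)
Let d2L_ge : 1 - dL <= 3 * d2L.
Proof. pull.
have tV1 := tV.
have tV0 : 0 < t^-1 by rewrite invr_gt0.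
have s0 : 10 / 9 <= be * (be + 1).
  have : 2 / 3 * (2 / 3 + 1) <= be * (be + 1) by rewrite ler_pM//; lra.
  by apply: le_trans; lra.
have tV2 : t^-1 <= t^-1 ^+ 2 by rewrite expr2 ler_peMl ?ltW.
have s1 : 10 / 9 * t^-1 ^+ 2 <= be * (be + 1) * t^-1 ^+ 2.
  by rewrite ler_wpM2r// sqr_ge0.
have s2 : 0 <= be * (1 - be) * t^-1.
  by rewrite mulr_ge0 ?ltW// mulr_gt0//; lra.
have s3 : 0 <= (1 - be) * (t^-1 - 1) by rewrite mulr_ge0//; lra.
have s4 : 1 + (be * t^-1 + 1 - be) <=
    3 * (be * (be + 1) * t^-1 ^+ 2 + be * (1 - be) * t^-1).
  by lra.
have : tau * (1 + (be * t^-1 + 1 - be)) <=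
    tau * (3 * (be * (be + 1) * t^-1 ^+ 2 + be * (1 - be) * t^-1)).
  by rewrite ler_wpM2l// ltW.
rewrite -exprVn in s1 *.
by lra.
Qed.

(* With [X = a * L * g], the last summand lets [12 * kappa * X ^+ 3] absorb the
   quadratic terms [(48 * Y0 + 96) * X ^+ 2], by Young's inequality. *)
Definition lower_order_bound := 6 * ((N + 4) ^+ 2 + 2) + 3 +
  (48 * Y0 + 96) ^+ 2 / (48 * kappa).

Hypothesis ha : lower_order_bound < a.

Let C2 := 48 * Y0 + 96.

Let a0 : 0 < a.
Proof. pull.
apply: le_lt_trans ha; rewrite /lower_order_bound.
by rewrite addr_ge0// ?divr_ge0 ?sqr_ge0 ?mulr_ge0// ?ltW//; have := sqr_ge0 (N + 4); lra.
Qed.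

Let aL0 : 0 < a * L. Proof. exact: mulr_gt0. Qed.

(** Since [x] and [rho] exceed 1, both [g / rho] and [y / x ^+ 2] are at most 1, so the loss is
    linear in [a * L]. *)
Let sG_ge : - (2 * ((N + 4) ^+ 2 + 2)) * (a * L) <= sG.
Proof. pull.
have gr0 : 0 <= g / rho by rewrite divr_ge0 ?ltW.
have gr1 : g / rho <= 1.
  by rewrite ler_pdivrMr// mul1r; apply: le_trans (ltW rho1); exact: le_trans y1.
have yx0 : 0 <= y / x ^+ 2 by rewrite divr_ge0 ?sqr_ge0 ?ltW.
have yx1 : y / x ^+ 2 <= 1.
  by rewrite ler_pdivrMr ?exprn_gt0// mul1r (le_trans y1)// exprn_ege1// ltW.
have s1 : (al + N - 4) ^+ 2 <= (N + 4) ^+ 2.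
  rewrite -subr_ge0 (_ : _ - _ = (8 - al) * (2 * N + al)); last by ring.
  by rewrite mulr_ge0//; lra.
have E2 : 0 <= E * (2 - al) by rewrite mulr_ge0//; lra.
have a3 : 0 <= (al - 1) * ((2 - al) * (3 - al)).
  by rewrite mulr_ge0//; [lra|rewrite mulr_ge0//; lra].
have s2 : E * (2 - al) * ((al + N - 4) ^+ 2 * (g / rho)) <= 1 * ((N + 4) ^+ 2 * 1).
  apply: ler_pM => //; first by rewrite mulr_ge0 ?sqr_ge0.
    have : E * (2 - al) <= 1 * 1 by apply: ler_pM => //; lra.
    lra.
  by apply: ler_pM => //; exact: sqr_ge0.
have s3 : (al - 1) * ((2 - al) * (3 - al)) * (y / x ^+ 2) <= 2 * 1.
  apply: ler_pM => //.
  have : (al - 1) * ((2 - al) * (3 - al)) <= 1 * (1 * 2).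
    apply: ler_pM; [lra|rewrite mulr_ge0//; lra|lra|].
    by apply: ler_pM; lra.
  lra.
have s4 : al * (E * (2 - al) * ((al + N - 4) ^+ 2 * (g / rho)) +
    (al - 1) * ((2 - al) * (3 - al)) * (y / x ^+ 2)) <= 2 * ((N + 4) ^+ 2 + 2).
  by apply: ler_pM; [lra|rewrite addr_ge0// mulr_ge0// mulr_ge0 ?sqr_ge0|lra|lra].
have := ler_wpM2r (ltW aL0) s4.
have -> : sG = - (al * (E * (2 - al) * ((al + N - 4) ^+ 2 * (g / rho)) +
    (al - 1) * ((2 - al) * (3 - al)) * (y / x ^+ 2)) * (a * L)).
  by move: (g / rho) (y / x ^+ 2) => c1 c2; ring.
by rewrite mulNr lerN2.
Qed.

Let X := a * L * g.

Let X0 : 0 < X. Proof. exact: mulr_gt0. Qed.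

Let X_le : X <= a * L.
Proof. by apply: ler_piMr; [exact: ltW aL0|exact: le_trans gy y1]. Qed.

(** The factors [rho] and [al ^+ 3], both at least 1, are given away. *)
Let cubic_ge : 12 * kappa * X ^+ 3 <= 12 * (a ^+ 3 * L ^+ 3 * al ^+ 3 * cubic_coef).
Proof.
pull.
have k1 : kappa * g ^+ 3 <= cubic_coef.
  apply: le_trans cubic_coef_ge; rewrite [leRHS]mulrAC ler_peMr//; last exact: ltW.
  by rewrite mulr_ge0// ?exprn_ge0// ltW.
have k2 : kappa * g ^+ 3 <= al ^+ 3 * cubic_coef.
  apply: (le_trans k1); rewrite ler_peMl//; last by rewrite exprn_ege1//; lra.
  by apply: (le_trans _ k1); rewrite mulr_ge0 ?ltW// exprn_gt0.
have k3 : (a * L) ^+ 3 * (kappa * g ^+ 3) <= (a * L) ^+ 3 * (al ^+ 3 * cubic_coef).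
  by rewrite ler_wpM2l// exprn_ge0// ltW.
rewrite -mulrA ler_pM2l//; apply: le_trans (le_trans k3 _).
  by rewrite /X [leLHS](_ : _ = (a * L) ^+ 3 * (kappa * g ^+ 3))//; ring.
by rewrite [leLHS](_ : _ = a ^+ 3 * L ^+ 3 * al ^+ 3 * cubic_coef)//; ring.
Qed.

(** From [p0 <= x ^+ 2 * y <= rho * Y0 * g] and [al ^+ 2 <= 4] come [48 = 12 * 4] and
    [96 = 24 * 4]. *)
Let square_ge : 12 * (a ^+ 2 * al ^+ 2 * E * L ^+ 2 * (2 - al) * g * (p0 / rho)) +
  24 * (a ^+ 2 * al ^+ 2 * E ^+ 2 * L ^+ 2 * g ^+ 2) <= C2 * X ^+ 2.
Proof.
pull.
have q0 : 0 <= p0 / rho by rewrite divr_ge0// ltW.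
have q1 : p0 / rho <= Y0 * g.
  apply: le_trans yg; rewrite ler_pdivrMr//.
  apply: (@le_trans _ _ (x * x * y)).
    by rewrite gerBl mulr_ge0 ?ltW// mulr_gt0.
  by rewrite mulrC ler_pM2l// -expr2.
have al4 : al ^+ 2 <= 2 ^+ 2 by rewrite ler_sqr ?nnegrE//; lra.
have e1 : E * (2 - al) <= 1 * 1 by apply: ler_pM; lra.
have e2 : E ^+ 2 <= 1 ^+ 2 by rewrite ler_sqr ?nnegrE//; lra.
have s1 : al ^+ 2 * (E * (2 - al)) * (p0 / rho) <= 2 ^+ 2 * (1 * 1) * (Y0 * g).
  have ? : 0 <= E * (2 - al) by rewrite mulr_ge0//; lra.
  apply: ler_pM => //; first by rewrite mulr_ge0// sqr_ge0.
  by apply: ler_pM => //; exact: sqr_ge0.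
have s2 : al ^+ 2 * E ^+ 2 <= 2 ^+ 2 * 1 ^+ 2 by apply: ler_pM => //; exact: sqr_ge0.
have aLg : 0 <= (a * L) ^+ 2 * g by rewrite mulr_ge0 ?sqr_ge0// ltW.
have r1 := ler_wpM2l aLg s1.
have r2 := ler_wpM2l (sqr_ge0 X) s2.
rewrite [leRHS](_ : _ = 12 * ((a * L) ^+ 2 * g * (2 ^+ 2 * (1 * 1) * (Y0 * g))) +
  24 * (X ^+ 2 * (2 ^+ 2 * 1 ^+ 2))); last by rewrite /C2 /X; ring.
apply: lerD.
  rewrite ler_pM2l//; apply: le_trans r1.
  by rewrite le_eqVlt; apply/orP; left; apply/eqP; move: (p0 / rho) => q; ring.
rewrite ler_pM2l//; apply: le_trans r2.
by rewrite le_eqVlt; apply/orP; left; apply/eqP; rewrite /X; ring.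
Qed.

(** On the left, [6 * ((N + 4) ^+ 2 + 2)] is three times the loss of [sG_ge], and 3 covers the
    [a * L] of the estimate plus at most [2 * a * L] from the Laplacian of the weight. All linear
    terms fit in [a * (a * L)] since [a] exceeds [lower_order_bound]. *)
Let absorb : C2 * X ^+ 2 + (6 * ((N + 4) ^+ 2 + 2) + 3) * (a * L) <=
  12 * kappa * X ^+ 3 + 2 * a ^+ 2 * L.
Proof.
have k48 : 0 < 48 * kappa by rewrite mulr_gt0.
(* Expanded: the cubic, minus [C2 * X ^+ 2], plus a remainder linear in [X]. *)
have s1 : 0 <= 12 * kappa * X * (X - C2 / (24 * kappa)) ^+ 2.
  by rewrite mulr_ge0 ?sqr_ge0// ltW// mulr_gt0// mulr_gt0.
have s2 : C2 * X ^+ 2 <= 12 * kappa * X ^+ 3 + C2 ^+ 2 / (48 * kappa) * X.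
  rewrite -subr_ge0; apply: le_trans s1 _; rewrite le_eqVlt; apply/orP; left.
  by apply/eqP; move: k0; move: C2 X (kappa) => c X' k k0'; field; rewrite gt_eqF.
have s3 : C2 ^+ 2 / (48 * kappa) * X <= C2 ^+ 2 / (48 * kappa) * (a * L).
  by rewrite ler_wpM2l// divr_ge0 ?sqr_ge0// ltW.
have s4 : (6 * ((N + 4) ^+ 2 + 2) + 3) * (a * L) +
    C2 ^+ 2 / (48 * kappa) * (a * L) <= a * (a * L).
  by rewrite -mulrDl ler_pM2r// ltW.
have s5 : 0 <= a * (a * L) by rewrite mulr_ge0 ?ltW.
move: s2 s3 s4 s5.
move: (C2 ^+ 2 / (48 * kappa)) => c.
rewrite (_ : 2 * a ^+ 2 * L = 2 * (a * (a * L))); last by ring.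
move: (12 * kappa * X ^+ 3) (C2 * X ^+ 2) ((6 * ((N + 4) ^+ 2 + 2) + 3) * (a * L))
  (c * (a * L)) (c * X) (a * (a * L)) => c1 c2 c3 c4 c5 c6 *; lra.
Qed.

(** By [half_P0] there are six copies of [a ^+ 2 * L * (- dL) * P0]: two pay
    [2 * a ^+ 2 * L ^+ 2 * P0], as [L <= - dL], and four yield the [2 * a ^+ 2 * L] spent in
    [absorb]. Three times the constant 2 of [zerothE] covers [4^-1]. *)
Theorem zeroth_order_inequality :
  2 * (a ^+ 2 * L ^+ 2 * P0) + a * al * (L * ((al - 1) * y - E * (g * (N + al - 2)))) -
    (a * (dL * p0) + 2 * t) + a * (L + p0) + 4^-1 <=
  3 * (sG - Ht + 2 * Hf + 2 * He * Fe).
Proof.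
rewrite zerothE; pull.
have dL1 : 1 <= - dL by apply: le_trans dL_ge.
have dL0 : 0 <= - dL by apply: le_trans dL1.
have aL := aL0; have ap := a0; have Lp := L0; have tp := t0.
have a2L : 0 <= a ^+ 2 * L by apply: mulr_ge0; [exact: sqr_ge0|exact: ltW].
have T1 : 0 <= a * p0 * (3 * d2L - (1 - dL)).
  by rewrite mulr_ge0 ?subr_ge0// mulr_ge0// ltW.
have T2 : 0 <= a ^+ 2 * L * (- dL) * (P0 - al * E * g * p0 - P0 / 2).
  by rewrite mulr_ge0 ?subr_ge0// mulr_ge0.
have Pp : 0 <= P0 by apply: le_trans P0_ge; lra.
have T3 : 0 <= a ^+ 2 * L * (- dL - L) * P0.
  by rewrite mulr_ge0// mulr_ge0// subr_ge0.
have T4 : 0 <= a ^+ 2 * L * (- dL * P0 - 1 * (1 / 2)).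
  by rewrite mulr_ge0// subr_ge0; apply: ler_pM => //; lra.
have T5 : 0 <= a * L * (2 - al * ((al - 1) * y - E * (g * (N + al - 2)))).
  have q0 : 0 <= E * (g * (N + al - 2)).
    by apply: mulr_ge0; [lra|apply: mulr_ge0; lra].
  have q1 : (al - 1) * y <= 1 * 1 by apply: ler_pM; lra.
  have q2 : al * ((al - 1) * y - E * (g * (N + al - 2))) <= al * 1.
    by rewrite ler_wpM2l//; lra.
  by apply: mulr_ge0; lra.
have T6 : 0 <= a * al * E * (- dL) * g.
  have aE : 0 <= a * al * E by apply: mulr_ge0; [apply: mulr_ge0; lra|lra].
  by apply: mulr_ge0; [exact: mulr_ge0|lra].
have T7 : 0 <= t * a * al * E * L * g.
  by rewrite -!mulrA; do 5 (apply: mulr_ge0; first lra); apply: mulr_ge0; lra.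
move: (cubic_ge) (square_ge) (absorb) (sG_ge).
rewrite -subr_ge0 => T11; rewrite -subr_ge0 => T10; rewrite -subr_ge0 => T9.
rewrite -subr_ge0 => T8; rewrite -subr_ge0.
set r := (X in 0 <= X - _); set l := (X in 0 <= _ - X).
(* An explicit certificate: the difference is a combination of the quantities just shown
   nonnegative. *)
suff -> : r - l =
  a * p0 * (3 * d2L - (1 - dL)) +
  12 * (a ^+ 2 * L * (- dL) * (P0 - al * E * g * p0 - P0 / 2)) +
  2 * (a ^+ 2 * L * (- dL - L) * P0) +
  4 * (a ^+ 2 * L * (- dL * P0 - 1 * (1 / 2))) +
  a * L * (2 - al * ((al - 1) * y - E * (g * (N + al - 2)))) +
  6 * (a * al * E * (- dL) * g) + 24 * (t * a * al * E * L * g) +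
  3 * (sG - - (2 * ((N + 4) ^+ 2 + 2)) * (a * L)) +
  (12 * kappa * X ^+ 3 + 2 * a ^+ 2 * L -
    (C2 * X ^+ 2 + (6 * ((N + 4) ^+ 2 + 2) + 3) * (a * L))) +
  (C2 * X ^+ 2 - (12 * (a ^+ 2 * al ^+ 2 * E * L ^+ 2 * (2 - al) * g * (p0 / rho)) +
    24 * (a ^+ 2 * al ^+ 2 * E ^+ 2 * L ^+ 2 * g ^+ 2))) +
  (12 * (a ^+ 3 * L ^+ 3 * al ^+ 3 * cubic_coef) - 12 * kappa * X ^+ 3) + 2 * t + 23 / 4.
  move: T1 T2 T3 T4 T5 T6 T7 T8 T9 T10 T11 tp.
  move: (_ * (3 * d2L - (1 - dL))) (_ * (P0 - al * E * g * p0 - P0 / 2))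
    (_ * (- dL - L) * P0) (_ * (- dL * P0 - 1 * (1 / 2))) (a * L * (2 - _))
    (a * al * E * (- dL) * g) (t * a * al * E * L * g) (sG - _)
    (_ - (C2 * X ^+ 2 + (6 * ((N + 4) ^+ 2 + 2) + 3) * (a * L)))
    (C2 * X ^+ 2 - _) (_ - 12 * kappa * X ^+ 3) => c1 c2 c3 c4 c5 c6 c7 c8 c9 c10 c11 *.
  lra.
rewrite /r /l; move: (cubic_coef) (kappa) C2 => cc k C2'.
move: (P0) (d2L) (p0 / rho) => PP d2 pr; move: (sG) (p0) (dL) => s p d.
rewrite /X; move: (L) => LL.
by field.
Qed.

End zeroth_order_inequality.

(** * Choice of the exponent *)

Section exponent.
Context (R : realType).

(* At [al = 2] the last quantity is [eps^2 (1 - eps^2) (1 - 3 eps^2)]. *)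
Lemma exists_exponent (eps : R) : 0 < eps -> eps ^+ 2 < 1 / 3 ->
  exists al : R, [/\ 4 / 3 <= al, al < 2, eps `^ al <= 2 / 5 &
    0 < eps ^+ 2 * (1 - eps `^ al) ^+ 2 * (al - 1 - 2 * eps `^ al) -
        2 * (eps `^ al) ^+ 3 * (1 - eps ^+ 2)].
Proof.
move=> e0 e3.
pose k (s : R) : R := eps ^+ 2 * (1 - eps `^ s) ^+ 2 * (s - 1 - 2 * eps `^ s) -
  2 * (eps `^ s) ^+ 3 * (1 - eps ^+ 2).
have cE : {for 2, continuous (fun s : R => eps `^ s)}.
  rewrite (_ : (fun s : R => _) = fun s => expR (s * ln eps)); last first.
    by apply/funext => s; rewrite /powR gt_eqF.
  apply: continuous_comp; last exact: continuous_expR.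
  by apply: cvgM; [exact: cvg_id|exact: cvg_cst].
have E2 : eps `^ 2 = eps ^+ 2 by rewrite -powR_mulrn// ltW.
have ck : {for 2, continuous k}.
  apply: cvgB; apply: cvgM.
  - apply: cvgM; first exact: cvg_cst.
    by rewrite expr2; apply: cvgM; apply: cvgB => //; exact: cvg_cst.
  - apply: cvgB; first by apply: cvgB; [exact: cvg_id|exact: cvg_cst].
    by apply: cvgM => //; exact: cvg_cst.
  - apply: cvgM; first exact: cvg_cst.
    by rewrite !exprS expr0 mulr1; apply: cvgM => //; apply: cvgM.
  - exact: cvg_cst.
have k2 : 0 < k 2.
  rewrite /k E2 (_ : _ - _ = eps ^+ 2 * (1 - eps ^+ 2) * (1 - 3 * eps ^+ 2)); last by ring.
  by rewrite mulr_gt0 ?mulr_gt0 ?exprn_gt0//; lra.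
have n1 : \forall s \near (2 : R), 0 < k s by move/cvgr_gt: ck; apply.
(* At [s = 2] this reads [eps ^+ 2 < 1 / 3 < 2 / 5], a strict inequality that persists nearby. *)
have n2 : \forall s \near (2 : R), eps `^ s < 2 / 5.
  by move/cvgr_lt: cE; apply; rewrite E2; lra.
have n3 : \forall s \near (2 : R), 4 / 3 < s by apply: lt_nbhsr; lra.
(* The other conditions are open at 2; approaching from the left adds [s < 2]. *)
have : \forall s \near (2 : R)^'-, [/\ 4 / 3 <= s, s < 2, eps `^ s <= 2 / 5 & 0 < k s].
  near=> s; split; last by near: s; exact: (cvg_within _ n1).
  - by apply: ltW; near: s; exact: (cvg_within _ n3).
  - by near: s; exact: nbhs_left_lt.
  - by apply: ltW; near: s; exact: (cvg_within _ n2).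
by move=> /filter_ex.
Unshelve. all: by end_near. Qed.

Lemma le_powR_npos (q u w : R) : q <= 0 -> 0 < u -> u <= w -> w `^ q <= u `^ q.
Proof.
move=> q0 u0 uw; have w0 := lt_le_trans u0 uw.
rewrite -[q]opprK 2!(powRN _ (- q)) lef_pV2 ?posrE ?powR_gt0//.
by apply: ge0_ler_powR; rewrite ?nnegrE ?oppr_ge0// ltW.
Qed.

End exponent.

(** * The weight on the cone *)

Section carleman_weight.
Context (R : realType) (n : nat).
Local Notation V := ('rV[R]_n.+1 * R)%type.
Local Notation N := (n.+1%:R : R).
Variables (eps al : R).
Local Notation E := (eps `^ al).
Hypotheses (eps0 : 0 < eps) (eps1 : eps < 1) (al43 : 4 / 3 <= al) (al2 : al < 2)
  (E25 : E <= 2 / 5)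
  (k0 : 0 < eps ^+ 2 * (1 - E) ^+ 2 * (al - 1 - 2 * E) - 2 * E ^+ 3 * (1 - eps ^+ 2)).

Definition in_cone : set V :=
  [set z | enorm z.1 * eps < xc 0 z /\ 1 < xc 0 z /\ 0 < tc z < 1].

Lemma enorm_rho (z : V) : enorm z.1 = Num.sqrt (rho z).
Proof. by []. Qed.

Lemma in_cone_half_space : in_cone `<=` @half_space R n.
Proof. by move=> z [_ [x1 /andP[t0 _]]]; split=> //; exact: lt_trans ltr01 x1. Qed.

Lemma weights_powR (z : V) : half_space z ->
  [/\ xc 0 z `^ al = xc 0 z * xc 0 z * yy al z,
      enorm z.1 `^ al = rho z * gg al z,
      gg al z = enorm z.1 `^ (al - 2) & Lam al (tc z) = Lm al z].
Proof.
move=> Uz; have r0 := rho_gt0 Uz; case: Uz => x0 t0.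
have gE : gg al z = enorm z.1 `^ (al - 2).
  by rewrite enorm_rho -powR12_sqrt ?ltW// -powRrM mulrC.
have split_pow (w : R) : 0 < w -> w `^ al = w * w * w `^ (al - 2).
  move=> w0; rewrite -expr2 -powR_mulrn ?ltW// -powRD ?(gt_eqF w0) ?implybT//.
  by congr (_ `^ _); ring.
split=> //.
- exact: split_pow.
- rewrite gE split_pow; last by rewrite enorm_rho sqrtr_gt0.
  by rewrite enorm_rho -expr2 sqr_sqrtr// ltW.
- by rewrite /Lam /Lm /tau powRN.
Qed.

Section at_point.
Variables (z : V) (Qz : in_cone z).
Let Uz := in_cone_half_space Qz.
Let x1 : 1 < xc 0 z. Proof. by case: Qz => _ []. Qed.
Let x0 : 0 < xc 0 z. Proof. exact: lt_trans ltr01 x1. Qed.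
Let t0 : 0 < tc z. Proof. by case: Qz => _ [_ /andP[]]. Qed.
Let t1 : tc z < 1. Proof. by case: Qz => _ [_ /andP[]]. Qed.
Let r0 : 0 < rho z. Proof. exact: rho_gt0. Qed.
Let s0 : 0 < enorm z.1. Proof. by rewrite enorm_rho sqrtr_gt0. Qed.
Let cone_z : eps * enorm z.1 <= xc 0 z. Proof. by rewrite mulrC ltW//; case: Qz. Qed.

Lemma zeroth_order_weight (a : R) :
  lower_order_bound al E N eps (eps `^ (al - 2)) < a ->
  2 * (a ^+ 2 * Lm al z ^+ 2 * grad2 al E z) + lap_weight al E a z - weight_t al E a z +
    a * (Lm al z + phi0 al E z) + 4^-1 <=
  3 * (lap_antisym al E a z - sym_t al E a z + 2 * sym_dot_weight al E a z +
       2 * sym_weight al E a z * multiplier al E a z).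
Proof.
have [_ _ gE _] := weights_powR Uz.
have q0 : al - 2 <= 0 by rewrite subr_le0 ltW.
apply: (@zeroth_order_inequality R a al E N (tc z) (tau al z) (xc 0 z) (rho z)
  (yy al z) (gg al z) eps (eps `^ (al - 2))) => //.
- exact: rho_ge.
- have -> : rho z = enorm z.1 ^+ 2 by rewrite enorm_rho sqr_sqrtr// ltW.
  have es0 : 0 < eps * enorm z.1 by exact: mulr_gt0.
  by rewrite -exprMn; apply: lerXn2r; rewrite // nnegrE ltW.
- by rewrite powR_gt0.
- rewrite gE; apply: le_powR_npos => //.
  rewrite enorm_rho -[leLHS]gtr0_norm// -sqrtr_sqr ler_sqrt// ?rho_ge//.
  exact: ltW.
(* The exponent is negative, so [eps * |x| <= x_1] bounds [yy] by [eps^(alpha-2)] times [gg]; this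
   is where [Y0] comes from. *)
- rewrite gE -powRM; [|exact: ltW..].
  by apply: le_powR_npos => //; exact: mulr_gt0.
- rewrite (_ : 1 = 1 `^ (al - 2)); last by rewrite powR1.
  by apply: le_powR_npos => //; exact: ltW.
- rewrite -[X in X * _]powRr1; last exact: ltW.
  rewrite -powRD ?(gt_eqF x0) ?implybT//.
  rewrite -[leLHS](powRr0 (xc 0 z)); apply: ler_powR; first exact: ltW.
  by have := al43; lra.
(* Nonnegativity of [varphi] is the cone condition raised to the power [alpha]. *)
- have [xE nE _ _] := weights_powR Uz.
  rewrite -xE -nE -powRM; [|exact: ltW..].
  rewrite subr_ge0; have := mulr_ge0 (ltW eps0) (ltW s0) => ?.
  by apply: ge0_ler_powR; rewrite ?nnegrE ?mulr_ge0// ?ltW//; have := al43; lra.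
- rewrite [leLHS](_ : 1 = 1 `^ (- (al / 2))); last by rewrite powR1.
  apply: le_powR_npos => //; last exact: ltW.
  by have := al43; lra.
- by rewrite powR_gt0.
- by rewrite ler1n.
Qed.

(** [F] cancels the multiple of the identity exactly; the two rank-one forms left have the
    favourable factors [al - 1] along [e_1] and [2 - al] along [x]. *)
Lemma hess_weight_ge0 (a : R) (xi : 'I_n.+1 -> R) : 0 < a ->
  0 <= 4 * (\sum_(i < n.+1) \sum_(j < n.+1)
      'D_(e_x R i) ('D_(e_x R j) (weight al E a)) z * xi i * xi j) -
    2 * multiplier al E a z * (\sum_(i < n.+1) xi i * xi i).
Proof.
move=> a0; rewrite hess_weight// /multiplier.
set S := \sum_(i < n.+1) xi i * xi i; set s := (\sum_(i < n.+1) _ ) ^+ 2.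
rewrite (_ : _ - _ = 4 * (a * al * Lm al z) *
  ((al - 1) * yy al z * xi 0 ^+ 2 + E * ((2 - al) * (gg al z / rho z) * s))); last first.
  by move: (xi 0) (yy al z) (Lm al z) (gg al z) (rho z) => A B C D F; ring.
have L0 : 0 < Lm al z by rewrite mulr_gt0 ?powR_gt0// subr_gt0.
have al0 : 0 < al by have := al43; lra.
apply: mulr_ge0; first by rewrite mulr_ge0// ltW// mulr_gt0// mulr_gt0.
apply: addr_ge0.
  apply: mulr_ge0; last exact: sqr_ge0.
  by apply: mulr_ge0; [have := al43; lra|exact: powR_ge0].
apply: mulr_ge0; first exact: powR_ge0.
apply: mulr_ge0; last exact: sqr_ge0.
apply: mulr_ge0; first by rewrite subr_ge0 ltW.
by rewrite divr_ge0 ?powR_ge0// ltW.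
Qed.

End at_point.
End carleman_weight.

Theorem proposition2p3 (R : realType) (n : nat) (hn : (2 <= n.+1)%N)
    (eps theta : R) (heps : 0 < eps < 1 / Num.sqrt 3)
    (htheta : 2 * acos (1 / Num.sqrt 3) < theta < pi)
    (heps_theta : eps = cos (theta / 2)) :
  exists alpha a0 : R, 1 < alpha < 2 /\
    forall (a : R) (u : 'rV[R]_n.+1 * R -> R),
      a0 < a -> test_function (Qcone theta) u ->
      (spacetime_integral (Qcone theta)
         (fun z => (expR (2 * phi eps alpha a z) *
            (a * (Lam alpha z.2 + vphi eps alpha z.1) * u z ^+ 2 +
             enorm (grad u z) ^+ 2))%R)
       <= 4%:E * spacetime_integral (Qcone theta)
         (fun z => (expR (2 * phi eps alpha a z) *
            `|dt u z + laplacian u z| ^+ 2)%R))%E.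
Proof.
have /andP[e0 e3] := heps.
have s3 : 0 < Num.sqrt 3 :> R by rewrite sqrtr_gt0.
have e33 : eps ^+ 2 < 1 / 3.
  have : eps ^+ 2 < (1 / Num.sqrt 3) ^+ 2 by rewrite ltr_sqr ?nnegrE ?ltW// divr_gt0.
  by rewrite expr_div_n expr1n sqr_sqrtr.
have e1 : eps < 1.
  rewrite -(@ltr_sqr _ eps 1) ?nnegrE ?ltW// expr1n; lra.
have [al [al43 al2 E25 k0]] := exists_exponent e0 e33.
(* The maximum with 0 provides the [0 < a] that the Hessian form requires. *)
pose a0 := Num.max 0 (lower_order_bound al (eps `^ al) n.+1%:R eps (eps `^ (al - 2))).
exists al, a0; split; first by rewrite al2 andbT; lra.
move=> a u; rewrite gt_max => /andP[ap ha] [su cK suppQ].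
pose K := supp u; pose U := @half_space R n.
have KQ z : K z -> in_cone eps z.
  move=> /suppQ [[/= c1 c2] c3]; split; last by [].
  by rewrite heps_theta.
have QU z : Qcone theta z -> U z.
  move=> [[/= _ x1] /andP[t0 _]]; split=> //; exact: lt_trans ltr01 x1.
have KU : K `<=` U by move=> z Kz; exact: QU (suppQ _ Kz).
have oU := @open_half_space R n.
pose p (z : 'rV[R]_n.+1 * R) := a * (Lm al z + phi0 al (eps `^ al) z).
have sy := @smooth_yy R n al; have sg := @smooth_gg R n al.
have st := @smooth_tau R n al; have sx := @smooth_xc R n.
have sr := @smooth_rho R n; have stc := @smooth_tc R n.
have sp : smoothOn U p by rewrite /p /Lm /phi0; smooth_rules oU.
have ssu : smooth_supp U K u.
  split; first exact: smooth_smoothOn.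
  move=> z Kz; apply/eqP; apply: contrapT => uz; apply: Kz.
  by apply: subset_closure; exact/negP.
pose f := weight al (eps `^ al) a : 'rV[R]_n.+1 * R -> R.
pose F := multiplier al (eps `^ al) a : 'rV[R]_n.+1 * R -> R.
have zeroth z : K z ->
    2 * (\sum_(i < n.+1) 'D_(e_x R i) f z * 'D_(e_x R i) f z) +
      \sum_(i < n.+1) 'D_(e_x R i) ('D_(e_x R i) f) z - 'D_(e_t R n.+1) f z + p z + 4^-1 <=
    3 * (\sum_(i < n.+1) 'D_(e_x R i) ('D_(e_x R i) (antisym_coef f F)) z -
      'D_(e_t R n.+1) (sym_coef f F) z +
      2 * (\sum_(i < n.+1) 'D_(e_x R i) (sym_coef f F) z * 'D_(e_x R i) f z) +
      2 * sym_coef f F z * F z).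
  move=> Kz; have Uz := KU _ Kz; rewrite /f /F grad_weight// laplacian_weight//.
  rewrite derive_weight_t//.
  rewrite laplacian_antisym_coef// derive_sym_coef_t// sym_coef_dot_weight// sym_coefE//.
  exact: (zeroth_order_weight e0 e1 al43 al2 E25 k0 (KQ z Kz) ha).
have main := @weighted_estimate R n.+1 U K oU cK KU f F p u (@smooth_weight _ _ _ _ _)
  (@smooth_multiplier _ _ _ _ _) sp ssu
  (fun z Kz xi => hess_weight_ge0 al43 al2 (KQ z Kz) xi ap) zeroth.
have clK : closed K by apply: compact_closed => //; exact: norm_hausdorff.
(* The integrals extend to the whole space since the extended integrand vanishes off [K], a subset
   of the cone; agreement is asked on the cone only, where the closed forms of the powers hold. *)
have intE g h : (forall z, Qcone theta z -> g z = h z) ->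
    (forall z, ~ K z -> h z = 0) -> spacetime_integral (Qcone theta) g =
    (\int[lebesgue_tuple R n.+1 \x @lebesgue_measure R]_z (h (@to_row R n.+1 z))%:E)%E.
  move=> gh h0; rewrite /spacetime_integral integral_mkcond.
  apply: eq_integral => z _; rewrite patchE.
  case: ifPn => [/set_mem /= Qz|/negP nQ]; first by rewrite gh.
  by rewrite h0// => Kz; apply: nQ; apply/mem_set; exact: suppQ.
have phiE (z : 'rV[R]_n.+1 * R) : Qcone theta z -> phi eps al a z = f z.
  move=> Qz; have [xE nE _ LE] := weights_powR al (QU z Qz).
  by rewrite /phi /vphi LE xE nE /f /weight /phi0; ring.
have vphiE (z : 'rV[R]_n.+1 * R) : Qcone theta z -> vphi eps al z.1 = phi0 al (eps `^ al) z.
  by move=> Qz; have [xE nE _ _] := weights_powR al (QU z Qz); rewrite /vphi xE nE.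
have LamE (z : 'rV[R]_n.+1 * R) : Qcone theta z -> Lam al z.2 = Lm al z.
  by move=> Qz; have [_ _ _ LE] := weights_powR al (QU z Qz); rewrite LE.
pose l z := expR (2 * f z) * (p z * u z ^+ 2 + \sum_(i < n.+1) 'D_(e_x R i) u z ^+ 2).
pose r z := expR (2 * f z) * `|'D_(e_t R n.+1) u z +
  \sum_(i < n.+1) 'D_(e_x R i) ('D_(e_x R i) u) z| ^+ 2.
rewrite (intE _ l); first (rewrite (intE _ r); first exact: main).
- by move=> z Qz; rewrite phiE.
- move=> z Kz; rewrite /r (smooth_supp_derive clK (e_t R n.+1) ssu).2// add0r.
  rewrite big1 ?normr0 ?expr0n ?mulr0// => i _.
  by rewrite (smooth_supp_derive clK _ (smooth_supp_derive clK _ ssu)).2.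
- move=> z Qz; rewrite /l phiE// LamE// vphiE// /enorm sqr_sqrtr; last first.
    by apply: sumr_ge0 => i _; exact: sqr_ge0.
  by congr (_ * (_ + _)); apply: eq_bigr => i _; rewrite mxE.
- move=> z Kz; rewrite /l ssu.2// expr0n mulr0 add0r big1 ?mulr0// => i _.
  by rewrite (smooth_supp_derive clK _ ssu).2// expr0n.
Qed.
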